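(* Every classical convex cap of dimension $3$ is infinitesimally rigid, in the following sense: for every triangulation of the non-base faces of $C$ by diagonals, every infinitesimal flex of $C$ is the restriction to the vertices of an infinitesimal rigid motion of $\mathbb{R}^3$ preserving the horizontal plane.
   Context: Let $\mathbb{R}^3_+=\{z\ge0\}$. A (classical) convex cap is a convex polytope $C\subset\mathbb{R}^3$ with $C\subset\mathbb{R}^3_+$, $C\cap\{z=0\}\neq\emptyset$ (this face is the base), such that the vertical projection to $\{z=0\}$ maps $C$ onto its base, and $\dim C\in\{2,3\}$. Let $p_1,\dots,p_m$ be the vertices of $C$, and triangulate each face of $C$ other than the base by diagonals. An infinitesimal flex of $C$ is a collection of vectors $p'_1,\dots,p'_m\in\mathbb{R}^3$ such that $(p'_i-p'_j)\cdot(p_i-p_j)=0$ whenever $p_ip_j$ is an edge of this triangulation (an edge of $C$ not in the relative interior of the base, or an added diagonal), and $p'_i$ is horizontal (has zero $z$-component) whenever $p_i$ lies in the plane $\{z=0\}$. An infinitesimal rigid motion preserving the horizontal plane is a vector field $p\mapsto a\times p+b$ with $a$ vertical and $b$ horizontal. *)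

(* Defs.v *)
From HB Require Import structures.
From mathcomp Require Import all_boot all_order all_algebra.
From mathcomp Require Import reals.
Set Implicit Arguments. Unset Strict Implicit. Unset Printing Implicit Defensive.
Import Order.TTheory GRing.Theory Num.Theory.
Local Open Scope ring_scope.

Section Caps.
Variable R : realType.
Local Notation vec := 'rV[R]_3.

Definition ix : 'I_3 := @Ordinal 3 0 isT.
Definition iy : 'I_3 := @Ordinal 3 1 isT.
Definition iz : 'I_3 := @Ordinal 3 2 isT.

Definition zc (v : vec) : R := v 0 iz.

Definition dot (u v : vec) : R := \sum_(k < 3) u 0 k * v 0 k.

(* cross product: (u x v)_k = u_(k+1) v_(k+2) - u_(k+2) v_(k+1), indices mod 3 *)
Definition crossmul (u v : vec) : vec :=
  \row_(k < 3) (u 0 (k + 1)%R * v 0 (k + 1 + 1)%R - u 0 (k + 1 + 1)%R * v 0 (k + 1)%R).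

Definition vproj (v : vec) : vec := \row_(k < 3) (if k == iz then 0 else v 0 k).

Definition horizontal (v : vec) : Prop := zc v = 0.
Definition vertical (v : vec) : Prop := v 0 ix = 0 /\ v 0 iy = 0.

Variable m : nat.
Variable p : 'I_m -> vec.

Definition in_hull (x : vec) : Prop :=
  exists lam : 'I_m -> R, (forall i, 0 <= lam i) /\ \sum_(i < m) lam i = 1 /\
    x = \sum_(i < m) lam i *: p i.

Definition extreme (x : vec) : Prop :=
  in_hull x /\ forall y z (t : R), in_hull y -> in_hull z -> 0 < t -> t < 1 ->
    x = (1 - t) *: y + t *: z -> y = z.

Definition are_vertices : Prop := injective p /\ forall i, extreme (p i).

Definition convex_cap : Prop :=
  (forall x, in_hull x -> 0 <= zc x) /\
  (exists x, in_hull x /\ zc x = 0) /\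
  (forall x, in_hull x -> in_hull (vproj x)).

Definition dim3 : Prop :=
  forall (a : vec) (b : R), (forall i, dot a (p i) = b) -> a = 0.

Definition supporting (a : vec) (b : R) : Prop :=
  a != 0 /\ forall x, in_hull x -> dot a x <= b.

Definition in_face (a : vec) (b : R) (x : vec) : Prop := in_hull x /\ dot a x = b.

Definition closed_seg (u v x : vec) : Prop :=
  exists t : R, 0 <= t /\ t <= 1 /\ x = (1 - t) *: u + t *: v.

Definition open_seg (u v x : vec) : Prop :=
  exists t : R, 0 < t /\ t < 1 /\ x = (1 - t) *: u + t *: v.

Definition edge (i j : 'I_m) : Prop :=
  i != j /\ exists a b, supporting a b /\
    forall x, in_face a b x <-> closed_seg (p i) (p j) x.

Definition face2 (a : vec) (b : R) : Prop :=
  supporting a b /\ exists x y z, in_face a b x /\ in_face a b y /\ in_face a b z /\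
    crossmul (y - x) (z - x) != 0.

Definition nonbase_face (a : vec) (b : R) : Prop :=
  face2 a b /\ ~ (forall x, in_face a b x <-> (in_hull x /\ zc x = 0)).

Definition diagonal (a : vec) (b : R) (i j : 'I_m) : Prop :=
  i != j /\ dot a (p i) = b /\ dot a (p j) = b /\ ~ edge i j.

Definition crossing (i j k l : 'I_m) : Prop :=
  exists x, open_seg (p i) (p j) x /\ open_seg (p k) (p l) x.

(* D is a triangulation of every non-base face of C by diagonals:
   a symmetric set of diagonals of non-base faces, pairwise non-crossing,
   and maximal with this property in each non-base face *)
Definition diag_triangulation (D : 'I_m -> 'I_m -> Prop) : Prop :=
  (forall i j, D i j -> D j i) /\
  (forall i j, D i j -> exists a b, nonbase_face a b /\ diagonal a b i j) /\
  (forall i j k l, D i j -> D k l -> crossing i j k l ->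
     (i = k /\ j = l) \/ (i = l /\ j = k)) /\
  (forall a b, nonbase_face a b -> forall k l, diagonal a b k l -> ~ D k l ->
     exists i j, D i j /\ crossing i j k l).

Definition inf_flex (D : 'I_m -> 'I_m -> Prop) (q : 'I_m -> vec) : Prop :=
  (forall i j, (edge i j \/ D i j) -> dot (q i - q j) (p i - p j) = 0) /\
  (forall i, zc (p i) = 0 -> horizontal (q i)).

(* q is the restriction of an infinitesimal rigid motion p |-> a x p + b
   with a vertical and b horizontal *)
Definition trivial_flex (q : 'I_m -> vec) : Prop :=
  exists a b : vec, vertical a /\ horizontal b /\
    forall i, q i = crossmul a (p i) + b.

End Caps.

(* Main.v *)
Require Import Defs.
From mathcomp Require Import all_boot all_order all_algebra.
From mathcomp Require Import boolp reals ring lra.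
Set Implicit Arguments. Unset Strict Implicit. Unset Printing Implicit Defensive.
Import Order.TTheory GRing.Theory Num.Theory.
Local Open Scope ring_scope.

(** The velocity q splits into a horizontal part (U, V) and a vertical part W.

    Within one non-base face the triangulation makes the tangential velocity
    rigid, so (q_i - q_j).(p_i - p_j) = 0 for all pairs of vertices on a common
    supporting plane meeting {z > 0}.

    W obeys a maximum principle.  On a vertical supporting plane W is affine in
    the horizontal coordinate and vanishes on the base, hence vanishes.  At any
    other vertex v above the base, turning counterclockwise around v across the
    edge vk changes the angular speed of the roof faces (about the vertical
    axis) by t (W_v - W_k) with t > 0.  If W_v is maximal this speed never
    decreases, and as one returns to the starting face the edges crossed have
    W_k = W_v.  They surround v, so one of them descends; a lowest maximum point
    is therefore on the base, where W = 0.  Applied to q and -q: W = 0.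

    Then every roof face moves by a planar rigid motion, which is the same for
    faces sharing an edge, hence for all roof faces; base vertices below a roof
    vertex are held by two vertical faces. *)

(** * Finite planar configurations *)

Lemma weighted_sum_eq0 (R : realDomainType) (I : finType) (l f : I -> R) :
  (forall i, 0 <= l i) -> (forall i, f i <= 0) -> \sum_i l i * f i = 0 ->
  forall i, l i != 0 -> f i = 0.
Proof.
move=> l0 f0 e i li.
have nn k : xpredT k -> 0 <= l k * - f k by rewrite mulr_ge0 // oppr_ge0.
have e' : \sum_k l k * - f k = 0.
  by under eq_bigr do rewrite mulrN; rewrite sumrN e oppr0.
have /eqP := psumr_eq0P nn e' (erefl (xpredT i)).
by rewrite mulf_eq0 (negbTE li) oppr_eq0 => /eqP.
Qed.

Lemma perp_two_eq0 (R : fieldType) (a b x1 y1 x2 y2 : R) : a * x1 + b * y1 = 0 -> a * x2 + b * y2 = 0 ->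
  x1 * y2 - y1 * x2 != 0 -> a = 0 /\ b = 0.
Proof.
move=> e1 e2 nz; split; apply: (mulIf nz); rewrite mul0r.
  transitivity (y2 * (a * x1 + b * y1) - y1 * (a * x2 + b * y2)); first by ring.
  by rewrite e1 e2; ring.
transitivity (x1 * (a * x2 + b * y2) - x2 * (a * x1 + b * y1)); first by ring.
by rewrite e1 e2; ring.
Qed.

Lemma exists_argmin (R : realDomainType) (I : finType) (P : I -> Prop) (f : I -> R) :
  (exists i, P i) -> exists2 i, P i & forall j, P j -> f i <= f j.
Proof.
case=> i0 Pi0; case: (@Order.TotalTheory.arg_minP _ _ I i0 (fun i => `[< P i >]) f).
  exact/asboolP.
move=> i /asboolP Pi le_f; exists i => // j Pj; exact/le_f/asboolP.
Qed.

Lemma exists_argmax (R : realDomainType) (I : finType) (P : I -> Prop) (f : I -> R) :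
  (exists i, P i) -> exists2 i, P i & forall j, P j -> f j <= f i.
Proof.
move=> /(exists_argmin (fun i => - f i)) [i Pi le_f]; exists i => // j Pj.
by rewrite -lerN2; exact: le_f.
Qed.

Section Planar.
Variables (R : realFieldType) (I : finType).
Implicit Types (X Y : I -> R) (P : I -> Prop).

Definition cross X Y i j := X i * Y j - Y i * X j.

Definition orient X Y i j (x y : R) :=
  (X j - X i) * (y - Y i) - (Y j - Y i) * (x - X i).

(* By Caratheodory three terms suffice: the negation says that the vectors are
   nonzero and span a pointed cone. *)
Definition balanced X Y P := exists i j k a b c,
  [/\ P i, P j & P k] /\ [/\ 0 <= a, 0 <= b, 0 <= c & 0 < a + b + c] /\
  a * X i + b * X j + c * X k = 0 /\ a * Y i + b * Y j + c * Y k = 0.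

(** Scan the points, keeping the clockwise-most ray [i]. A point [l] strictly clockwise of [i] takes
    over, unless some earlier [k] lies strictly clockwise of [l]; then [l], [i], [k] wind around the
    origin. *)
Lemma extreme_ray X Y P : (exists i, P i) ->
  (exists2 i, P i & forall j, P j -> 0 <= cross X Y i j) \/ balanced X Y P.
Proof.
move=> [i0 Pi0].
suff /(_ (enum I)) [[i Pi Hi]|] : forall s : seq I,
  (exists2 i, P i & forall j, j \in s -> P j -> 0 <= cross X Y i j) \/ balanced X Y P.
- by left; exists i => // j; apply: Hi; rewrite mem_enum.
- by right.
elim=> [|l s [[i Pi Hi]|]]; [by left; exists i0| |by right].
have [Pl|nPl] := pselect (P l); last first.
  by left; exists i => // j; rewrite inE => /predU1P[->|]; [move/nPl|exact: Hi].
have [il|li] := lerP 0 (cross X Y i l).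
  by left; exists i => // j; rewrite inE => /predU1P[->|]; [move=> _|exact: Hi].
have [[k [ks Pk lk]]|nk] := pselect (exists k, [/\ k \in s, P k & cross X Y l k < 0]).
  (* Cramer's identity: each vector is weighted by the cross product of the other two. *)
  right; exists l, i, k, (cross X Y i k), (cross X Y k l), (cross X Y l i).
  have := Hi k ks Pk; move: li lk; rewrite /cross => li lk ik.
  by split=> //; split; [split; lra|split; ring].
left; exists l => // j; rewrite inE => /predU1P[->|js] Pj; first by rewrite /cross mulrC subrr.
by rewrite leNgt; apply/negP => lj; apply: nk; exists j.
Qed.

(** Exchanging the two coordinates reverses the orientation. *)
Lemma extreme_ray_last X Y P : (exists i, P i) ->
  (exists2 i, P i & forall j, P j -> cross X Y i j <= 0) \/ balanced X Y P.
Proof.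
move=> /(extreme_ray Y X) [[i Pi Hi]|[i [j [k [a [b [c [Ps [nn [e1 e2]]]]]]]]]].
  by left; exists i => // j /Hi; rewrite /cross; lra.
by right; exists i, j, k, a, b, c.
Qed.

Definition spans X Y P := exists i j k, [/\ P i, P j & P k] /\ orient X Y i j (X k) (Y k) != 0.

(** The weights are not normalised, and the triangle may be degenerate. *)
Definition in_triangle X Y P x y := exists i j k a b c,
  [/\ P i, P j & P k] /\ [/\ 0 <= a, 0 <= b, 0 <= c & 0 < a + b + c] /\
  (a + b + c) * x = a * X i + b * X j + c * X k /\
  (a + b + c) * y = a * Y i + b * Y j + c * Y k.

(* The tangent from (x, y) to the point set touches it first at i; the first edge
   met when turning about i away from (x, y) separates. *)
Lemma triangle_or_side X Y P x y : spans X Y P ->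
  in_triangle X Y P x y \/
  exists i j, [/\ P i, P j, forall k, P k -> 0 <= orient X Y i j (X k) (Y k)
                & orient X Y i j x y < 0].
Proof.
move=> sp; have neP : exists i, P i by case: sp => i [j [k [[Pi _ _] _]]]; exists i.
pose dx i := X i - x; pose dy i := Y i - y.
have [[i0 Pi0 Hi0]|[i [j [k [a [b [c [Ps [nn [e1 e2]]]]]]]]]] := @extreme_ray dx dy P neP; last first.
  left; exists i, j, k, a, b, c; split=> //; split=> //.
  by move: e1 e2; rewrite /dx /dy => e1 e2; split; lra.
have [[i [j [k [a [b [c [Ps [nn [e1 e2]]]]]]]]]|nb] := pselect (balanced dx dy P).
  left; exists i, j, k, a, b, c; split=> //; split=> //.
  by move: e1 e2; rewrite /dx /dy => e1 e2; split; lra.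
right.
(* Two terms already make a balance; this rules out zero vectors and opposite pairs. *)
have par i j a b : P i -> P j -> 0 <= a -> 0 <= b -> 0 < a + b ->
    a * dx i + b * dx j = 0 -> a * dy i + b * dy j = 0 -> False.
  move=> Pi Pj a0 b0 ab e1 e2; apply: nb; exists i, j, j, a, b, 0.
  by rewrite !addr0 !mul0r !addr0; split.
have [i [Pi ci] mini] : exists2 i, P i /\ cross dx dy i0 i = 0 &
   forall j, P j /\ cross dx dy i0 j = 0 -> dx i0 * dx i + dy i0 * dy i <= dx i0 * dx j + dy i0 * dy j.
  by apply: exists_argmin; exists i0; split=> //; rewrite /cross; ring.
have n0 j : P j -> 0 < dx j ^+ 2 + dy j ^+ 2.
  move=> Pj; rewrite lt_neqAle addr_ge0 ?sqr_ge0 // andbT eq_sym paddr_eq0 ?sqr_ge0 //.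
  rewrite !sqrf_eq0; apply/negP => /andP[/eqP e1 /eqP e2].
  by apply: (@par j j 1 0) => //; rewrite ?e1 ?e2; lra.
have pos j : P j -> cross dx dy i0 j = 0 -> 0 < dx i0 * dx j + dy i0 * dy j.
  move=> Pj c0; rewrite ltNge; apply/negP => le0.
  apply: (@par i0 j (- (dx i0 * dx j + dy i0 * dy j)) (dx i0 ^+ 2 + dy i0 ^+ 2)) => //.
  - by lra.
  - exact/ltW/n0.
  - by have := n0 _ Pi0; lra.
  - have -> : - (dx i0 * dx j + dy i0 * dy j) * dx i0 + (dx i0 ^+ 2 + dy i0 ^+ 2) * dx j
        = - dy i0 * cross dx dy i0 j by rewrite /cross; ring.
    by rewrite c0 mulr0.
  - have -> : - (dx i0 * dx j + dy i0 * dy j) * dy i0 + (dx i0 ^+ 2 + dy i0 ^+ 2) * dy j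
        = dx i0 * cross dx dy i0 j by rewrite /cross; ring.
    by rewrite c0 mulr0.
(* i is the point of the tangent line nearest to (x, y) *)
pose r := (dx i0 * dx i + dy i0 * dy i).
pose n2 := dx i0 ^+ 2 + dy i0 ^+ 2.
have r0 : 0 < r by exact: pos.
have n20 : 0 < n2 by exact: n0.
have eix : n2 * dx i = r * dx i0.
  have -> : n2 * dx i = r * dx i0 - dy i0 * cross dx dy i0 i by rewrite /n2 /r /cross; ring.
  by rewrite ci mulr0 subr0.
have eiy : n2 * dy i = r * dy i0.
  have -> : n2 * dy i = r * dy i0 + dx i0 * cross dx dy i0 i by rewrite /n2 /r /cross; ring.
  by rewrite ci mulr0 addr0.
have Hi j : P j -> 0 <= cross dx dy i j.
  move=> Pj; rewrite -(pmulr_rge0 _ n20).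
  have -> : n2 * cross dx dy i j = r * cross dx dy i0 j.
    by rewrite /cross !mulrBr !mulrA eix eiy; ring.
  by rewrite mulr_ge0 ?Hi0 // ltW.
pose ex j := X j - X i; pose ey j := Y j - Y i.
have cie j : cross dx dy i j = dx i * ey j - dy i * ex j by rewrite /cross /dx /dy /ex /ey; ring.
have ni : 0 < dx i ^+ 2 + dy i ^+ 2 by exact: n0.
have cie0 j : P j -> 0 <= dx i * ey j - dy i * ex j by move=> /Hi; rewrite cie.
have dot0 j : P j -> dx i * ey j - dy i * ex j = 0 -> 0 <= dx i * ex j + dy i * ey j.
  move=> Pj e0; rewrite -(pmulr_rge0 _ n20).
  have -> : n2 * (dx i * ex j + dy i * ey j) = r * (dx i0 * ex j + dy i0 * ey j).
    by rewrite mulrDr !mulrA eix eiy; ring.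
  rewrite pmulr_rge0 //.
  have cj : cross dx dy i0 j = 0.
    apply: (mulfI (lt0r_neq0 r0)); rewrite mulr0.
    have -> : r * cross dx dy i0 j = n2 * cross dx dy i j.
      by rewrite /cross !mulrBr !mulrA eix eiy; ring.
    by rewrite cie e0 mulr0.
  by have := mini j (conj Pj cj); rewrite /dx /dy /ex /ey; lra.
pose T j := P j /\ 0 < ex j ^+ 2 + ey j ^+ 2.
have nT j : ~ 0 < ex j ^+ 2 + ey j ^+ 2 -> ex j = 0 /\ ey j = 0.
  move/negP; rewrite -leNgt => le0.
  have /eqP : ex j ^+ 2 + ey j ^+ 2 = 0 by apply/le_anti; rewrite le0 addr_ge0 ?sqr_ge0.
  by rewrite paddr_eq0 ?sqr_ge0 // !sqrf_eq0 => /andP[/eqP-> /eqP->].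
have dotT j : T j -> dx i * ey j - dy i * ex j = 0 -> 0 < dx i * ex j + dy i * ey j.
  move=> [Pj ej] e0; rewrite lt_neqAle dot0 // andbT eq_sym; apply/eqP => d0.
  have := mulr_gt0 ni ej.
  have -> : (dx i ^+ 2 + dy i ^+ 2) * (ex j ^+ 2 + ey j ^+ 2) =
    (dx i * ey j - dy i * ex j) ^+ 2 + (dx i * ex j + dy i * ey j) ^+ 2 by ring.
  by rewrite e0 d0 expr0n /= addr0 ltxx.
(* By [spans], the points cannot all lie on the tangent line. *)
have flat : (forall j, P j -> dx i * ey j - dy i * ex j = 0) -> False.
  move=> fl; case: sp => a [b [c [[/fl Pa /fl Pb /fl Pc] /negP]]]; apply; apply/eqP.
  have e1 : dx i * orient X Y a b (X c) (Y c) = 0.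
    have -> : dx i * orient X Y a b (X c) (Y c) =
      (ex b - ex a) * ((dx i * ey c - dy i * ex c) - (dx i * ey a - dy i * ex a)) -
      (ex c - ex a) * ((dx i * ey b - dy i * ex b) - (dx i * ey a - dy i * ex a)).
      by rewrite /orient /ex /ey; ring.
    by rewrite Pa Pb Pc; ring.
  have e2 : dy i * orient X Y a b (X c) (Y c) = 0.
    have -> : dy i * orient X Y a b (X c) (Y c) =
      (ey b - ey a) * ((dx i * ey c - dy i * ex c) - (dx i * ey a - dy i * ex a)) -
      (ey c - ey a) * ((dx i * ey b - dy i * ex b) - (dx i * ey a - dy i * ex a)).
      by rewrite /orient /ex /ey; ring.
    by rewrite Pa Pb Pc; ring.
  apply: (mulfI (lt0r_neq0 ni)); rewrite mulr0 mulrDl !expr2 -!mulrA e1 e2; ring.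
have neT : exists j, T j.
  have [//|none] := pselect (exists j, T j); exfalso; apply: flat => j Pj.
  have [-> ->] : ex j = 0 /\ ey j = 0 by apply: nT => e; apply: none; exists j.
  by ring.
have [[k [Pk ek] Hk]|[j [k [l [a [b [c [[Tj Tk Tl] [[a0 b0 c0 abc] [e1 e2]]]]]]]]]] :=
  @extreme_ray_last ex ey T neT; last first.
  (* In a balance around [i] all terms lie on one closed side of the tangent line, hence on the line
     itself. There they all point away from (x, y), so every weight vanishes. *)
  exfalso.
  have term t u : T u -> 0 <= t -> 0 <= t * (dx i * ey u - dy i * ex u) /\
     (t * (dx i * ey u - dy i * ex u) = 0 ->
      0 <= t * (dx i * ex u + dy i * ey u) /\ (t * (dx i * ex u + dy i * ey u) = 0 -> t = 0)).
    move=> Tu t0; split; first by rewrite mulr_ge0 // cie0 //; case: Tu.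
    move/eqP; rewrite mulf_eq0 => /orP[/eqP->|/eqP cu]; first by rewrite mul0r.
    have du := dotT u Tu cu; split; first by rewrite mulr_ge0 // ltW.
    by move/eqP; rewrite mulf_eq0 (gt_eqF du) orbF => /eqP.
  have [ja jb] := term a j Tj a0; have [ka kb] := term b k Tk b0; have [la lb] := term c l Tl c0.
  have s1 : a * (dx i * ey j - dy i * ex j) + b * (dx i * ey k - dy i * ex k) +
            c * (dx i * ey l - dy i * ex l) = 0.
    transitivity (dx i * (a * ey j + b * ey k + c * ey l) - dy i * (a * ex j + b * ex k + c * ex l)).
      by ring.
    by rewrite e1 e2; ring.
  have s2 : a * (dx i * ex j + dy i * ey j) + b * (dx i * ex k + dy i * ey k) +
            c * (dx i * ex l + dy i * ey l) = 0.
    transitivity (dx i * (a * ex j + b * ex k + c * ex l) + dy i * (a * ey j + b * ey k + c * ey l)).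
      by ring.
    by rewrite e1 e2; ring.
  have {}jb := jb ltac:(lra); have {}kb := kb ltac:(lra); have {}lb := lb ltac:(lra).
  have aa := jb.2 ltac:(lra); have bb := kb.2 ltac:(lra); have cc := lb.2 ltac:(lra).
  by move: abc; rewrite aa bb cc; lra.
have Hk' l : P l -> cross ex ey k l <= 0.
  move=> Pl; have [Tl|/nT[e1 e2]] := pselect (0 < ex l ^+ 2 + ey l ^+ 2); first exact: Hk.
  by rewrite /cross e1 e2; lra.
exists k, i; split=> //.
  by move=> l /Hk'; rewrite /orient /cross /ex /ey; lra.
(* The separation is strict: if the edge from [i] to [k] ran along the tangent line, all points
   would lie on that line. *)
suff : 0 < dx i * ey k - dy i * ex k by rewrite /orient /dx /dy /ex /ey; lra.
rewrite lt_neqAle cie0 // andbT eq_sym; apply/eqP => ck.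
apply: flat => l Pl; apply/le_anti; rewrite cie0 // andbT.
have dk := dotT k (conj Pk ek) ck.
rewrite -(pmulr_rle0 _ dk).
have -> : (dx i * ex k + dy i * ey k) * (dx i * ey l - dy i * ex l) =
  (dx i ^+ 2 + dy i ^+ 2) * cross ex ey k l +
  (dx i * ey k - dy i * ex k) * (dx i * ex l + dy i * ey l) by rewrite /cross; ring.
by rewrite ck mul0r addr0 pmulr_rle0 // Hk'.
Qed.
End Planar.

(** * Planes above a finite point set *)

Section UpperPlanes.
Variables (R : realFieldType) (I : finType) (X Y Z : I -> R).

Definition above (a1 a2 b : R) := forall l, Z l <= b + a1 * X l + a2 * Y l.
Definition touch (a1 a2 b : R) l := Z l = b + a1 * X l + a2 * Y l.

(** Contact points with non-collinear shadows determine the plane. *)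
Definition upper_face a1 a2 b := above a1 a2 b /\ spans X Y (touch a1 a2 b).

(** Ratio test: among the points where [h] is negative, the one minimising gap over [- h] is the
    first that the moving plane reaches, and [t] is that ratio. *)
Lemma tilt a1 a2 b h0 h1 h2 : above a1 a2 b ->
  (forall l, touch a1 a2 b l -> 0 <= h0 + h1 * X l + h2 * Y l) ->
  (exists l, h0 + h1 * X l + h2 * Y l < 0) ->
  exists t, [/\ 0 < t, above (a1 + t * h1) (a2 + t * h2) (b + t * h0) &
    exists2 l, h0 + h1 * X l + h2 * Y l < 0 & touch (a1 + t * h1) (a2 + t * h2) (b + t * h0) l].
Proof.
move=> ab ht neg.
pose h l := h0 + h1 * X l + h2 * Y l; pose g l := b + a1 * X l + a2 * Y l - Z l.
have [l hl minl] := exists_argmin (fun l => g l / - h l) neg.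
have gl : 0 < g l.
  rewrite lt_neqAle subr_ge0 ab andbT eq_sym subr_eq0; apply/eqP => tl.
  by have := ht l (esym tl); rewrite leNgt hl.
have hl' : 0 < - h l by rewrite oppr_gt0.
have t0 : 0 < g l / - h l by rewrite divr_gt0.
exists (g l / - h l); split=> //.
  move=> k; have gk : 0 <= g k by rewrite subr_ge0 ab.
  suff : 0 <= g k + g l / - h l * h k by rewrite /g /h; lra.
  have [hk|hk] := lerP 0 (h k); first by rewrite addr_ge0 // mulr_ge0 // ltW.
  have := minl k hk; rewrite ler_pdivlMr ?oppr_gt0 //; lra.
exists l => //; rewrite /touch.
have e : g l / - h l * - h l = g l by rewrite divfK // gt_eqF.
by move: e; set t := g l / - h l; rewrite /g /h; lra.
Qed.

Hypothesis wide : forall h0 h1 h2, (forall l, h0 + h1 * X l + h2 * Y l = 0) -> h1 = 0 /\ h2 = 0.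

(** By [wide] a non-constant affine function with a zero at some point is nonzero at another one;
    [s] adjusts the sign. *)
Lemma wide_neg l0 h0 h1 h2 : h0 + h1 * X l0 + h2 * Y l0 = 0 -> (h1 != 0) || (h2 != 0) ->
  exists s : R, exists l, s * h0 + s * h1 * X l + s * h2 * Y l < 0.
Proof.
move=> e0 nz.
have [[l hl]|none] := pselect (exists l, h0 + h1 * X l + h2 * Y l != 0).
  have [hlt|hgt|e] := ltgtP (h0 + h1 * X l + h2 * Y l) 0.
  - by exists 1, l; lra.
  - by exists (-1), l; lra.
  - by rewrite e eqxx in hl.
case: (@wide h0 h1 h2) => [l|e1 e2]; last by rewrite e1 e2 eqxx in nz.
by apply/eqP/negPn/negP => hl; apply: none; exists l.
Qed.

(** Start from the horizontal plane through a highest point [i]. Tilt it about a line through [i]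
    until a contact [k] with another shadow appears, then about the line through [i] and [k] until
    the contacts are no longer collinear. *)
Lemma upper_face_exists : (exists l : I, True) -> exists a1 a2 b, upper_face a1 a2 b.
Proof.
move=> [l0 _].
have [i _ maxi] := exists_argmax (P := fun _ => True) Z (ex_intro _ l0 Logic.I).
have [a1 [a2 [b [ab ti [k [tk nk]]]]]] : exists a1 a2 b, [/\ above a1 a2 b, touch a1 a2 b i &
    exists k, touch a1 a2 b k /\ ((X k - X i != 0) || (Y k - Y i != 0))].
  have ab0 : above 0 0 (Z i) by move=> l; have := maxi l Logic.I; lra.
  have ti0 : touch 0 0 (Z i) i by rewrite /touch; lra.
  have [[k hk]|none] := pselect (exists k, touch 0 0 (Z i) k /\ ((X k - X i != 0) || (Y k - Y i != 0))).
    by exists 0, 0, (Z i); split=> //; exists k.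
  have [s neg] : exists s : R, exists l, s * (- X i) + s * 1 * X l + s * 0 * Y l < 0.
    by apply: (@wide_neg i); [lra|rewrite oner_eq0].
  have [|t [t0 ab1 [l hl tl]]] := tilt ab0 _ neg.
    move=> l tl; have := none; have [e|e] := eqVneq (X l - X i) 0; last first.
      by case; exists l; rewrite e.
    by move=> _; rewrite (_ : X l = X i) //; lra.
  eexists; eexists; eexists; split; [exact: ab1| |exists l; split; [exact: tl|]].
    by rewrite /touch; lra.
  by apply/orP; left; apply/eqP => e; move: hl; rewrite (_ : X l = X i) //; lra.
have [sp|nsp] := pselect (spans X Y (touch a1 a2 b)); first by exists a1, a2, b.
pose h0 := - (X k - X i) * Y i + (Y k - Y i) * X i.
have [s neg] : exists s : R, exists l,
    s * h0 + s * - (Y k - Y i) * X l + s * (X k - X i) * Y l < 0.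
  apply: (@wide_neg i); first by rewrite /h0; ring.
  by rewrite oppr_eq0 orbC.
have ho l : s * h0 + s * - (Y k - Y i) * X l + s * (X k - X i) * Y l =
            s * orient X Y i k (X l) (Y l) by rewrite /h0 /orient; ring.
have [|t [t0 ab1 [l hl tl]]] := tilt ab _ neg.
  move=> l tl; rewrite ho.
  suff -> : orient X Y i k (X l) (Y l) = 0 by rewrite mulr0.
  by apply/eqP/negPn/negP => o; apply: nsp; exists i, k, l.
eexists; eexists; eexists; split; [exact: ab1|exists i, k, l; split; first split].
- by move: ti; rewrite /touch => ->; rewrite /h0; ring.
- by move: tk; rewrite /touch => ->; rewrite /h0; ring.
- exact: tl.
- by apply/eqP => e; move: hl; rewrite ho e mulr0 ltxx.
Qed.

(* Dual simplex: a face of F of least height over (x, y) touches over (x, y), since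
   otherwise tilting it about a separating side would lower it. *)
Lemma upper_face_cover (F : R -> R -> R -> Prop) (x y : R) :
  (exists a1 a2 b, upper_face a1 a2 b /\ F a1 a2 b) ->
  (forall a1 a2 b a1' a2' b' i j, upper_face a1 a2 b -> upper_face a1' a2' b' -> F a1 a2 b ->
     touch a1 a2 b i -> touch a1 a2 b j -> touch a1' a2' b' i -> touch a1' a2' b' j ->
     (X j - X i != 0) || (Y j - Y i != 0) -> F a1' a2' b') ->
  (forall h0 h1 h2, h0 + h1 * x + h2 * y < 0 -> exists l, h0 + h1 * X l + h2 * Y l < 0) ->
  exists a1 a2 b, [/\ upper_face a1 a2 b, F a1 a2 b & in_triangle X Y (touch a1 a2 b) x y].
Proof.
move=> ini clo inside.
(* Height over (x, y) of the plane through three points, in barycentric form. It depends on the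
   triple only, so the minimum is taken over a finite set. *)
pose val (t : I * I * I) := let: (i, j, k) := t in
  (Z i * orient X Y j k x y + Z j * orient X Y k i x y + Z k * orient X Y i j x y) /
  orient X Y i j (X k) (Y k).
pose G (t : I * I * I) a1 a2 b := let: (i, j, k) := t in
  [/\ upper_face a1 a2 b, F a1 a2 b, [/\ touch a1 a2 b i, touch a1 a2 b j & touch a1 a2 b k] &
      orient X Y i j (X k) (Y k) != 0].
have valE t a1 a2 b : G t a1 a2 b -> val t = b + a1 * x + a2 * y.
  case: t => [[i j] k] [_ _ [ti tj tk] nz]; rewrite /val ti tj tk.
  have -> : (b + a1 * X i + a2 * Y i) * orient X Y j k x y +
    (b + a1 * X j + a2 * Y j) * orient X Y k i x y + (b + a1 * X k + a2 * Y k) * orient X Y i j x y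
    = (b + a1 * x + a2 * y) * orient X Y i j (X k) (Y k) by rewrite /orient; ring.
  by rewrite mulfK.
have [|t [a1 [a2 [b Gt]]] mint] := @exists_argmin _ _ (fun t => exists a1 a2 b, G t a1 a2 b) val.
  case: ini => a1 [a2 [b [[ab [i [j [k [ts nz]]]]] Fa]]].
  by exists (i, j, k), a1, a2, b; split=> //; split=> //; exists i, j, k.
have [uf Fa] : upper_face a1 a2 b /\ F a1 a2 b by case: (t) Gt => [[i j] k] [].
have [ab sp] := uf.
exists a1, a2, b; split=> //.
have [//|[i [j [ti tj side neg]]]] := triangle_or_side x y sp; exfalso.
(* The tilting function is [orient X Y i j]: it vanishes along the separating side and is negative
   at (x, y). *)
pose h0 := - (X j - X i) * Y i + (Y j - Y i) * X i.
have ho u w : h0 + - (Y j - Y i) * u + (X j - X i) * w = orient X Y i j u w.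
  by rewrite /h0 /orient; ring.
have [||s [s0 ab1 [l hl tl]]] := @tilt a1 a2 b h0 (- (Y j - Y i)) (X j - X i) ab.
- by move=> l /side; rewrite ho.
- by apply: inside; rewrite ho.
rewrite ho in hl.
have ti' : touch (a1 + s * - (Y j - Y i)) (a2 + s * (X j - X i)) (b + s * h0) i.
  by move: ti; rewrite /touch => ->; rewrite /h0; ring.
have tj' : touch (a1 + s * - (Y j - Y i)) (a2 + s * (X j - X i)) (b + s * h0) j.
  by move: tj; rewrite /touch => ->; rewrite /h0; ring.
have uf' : upper_face (a1 + s * - (Y j - Y i)) (a2 + s * (X j - X i)) (b + s * h0).
  by split=> //; exists i, j, l; split=> //; rewrite lt_eqF.
have G' : G (i, j, l) (a1 + s * - (Y j - Y i)) (a2 + s * (X j - X i)) (b + s * h0).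
  split=> //; last by rewrite lt_eqF.
  apply: clo uf uf' Fa ti tj ti' tj' _; apply/negPn; rewrite negb_or !negbK.
  by apply/negP => /andP[/eqP e1 /eqP e2]; move: neg; rewrite /orient e1 e2; lra.
have := mint (i, j, l); move/(_ ltac:(do 3!eexists; exact: G')).
rewrite (valE _ _ _ _ Gt) (valE _ _ _ _ G') => le.
have : s * orient X Y i j x y < 0 by rewrite pmulr_rlt0.
by rewrite -ho; lra.
Qed.

End UpperPlanes.

(** * Faces and their triangulations *)

Section Vectors.
Variable R : realType.
Implicit Types u v w x y : 'rV[R]_3.

Lemma ord3P (k : 'I_3) : [\/ k = ix, k = iy | k = iz].
Proof.
by case: k => [[|[|[|//]]] lt]; [apply: Or31|apply: Or32|apply: Or33]; exact: val_inj.
Qed.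

Lemma vecP u v : u 0 ix = v 0 ix -> u 0 iy = v 0 iy -> u 0 iz = v 0 iz -> u = v.
Proof. by move=> ex ey ez; apply/rowP => k; case: (ord3P k) => ->. Qed.

Lemma dotE u v : dot u v = u 0 ix * v 0 ix + u 0 iy * v 0 iy + u 0 iz * v 0 iz.
Proof.
rewrite /dot !big_ord_recl big_ord0 addr0 addrA.
by congr (_ * _ + _ * _ + _ * _); congr (_ 0 _); exact: val_inj.
Qed.

Definition mkvec (a b c : R) : 'rV[R]_3 :=
  \row_k (if k == ix then a else if k == iy then b else c).

Lemma mkvecE a b c : (mkvec a b c 0 ix = a) * (mkvec a b c 0 iy = b) * (mkvec a b c 0 iz = c).
Proof. by rewrite !mxE. Qed.

Lemma crossmulE u v :
  (crossmul u v 0 ix = u 0 iy * v 0 iz - u 0 iz * v 0 iy) *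
  (crossmul u v 0 iy = u 0 iz * v 0 ix - u 0 ix * v 0 iz) *
  (crossmul u v 0 iz = u 0 ix * v 0 iy - u 0 iy * v 0 ix).
Proof.
rewrite !mxE.
have e1 : ix + 1 = iy by exact: val_inj.
have e2 : iy + 1 = iz by exact: val_inj.
have e3 : iz + 1 = ix by exact: val_inj.
by rewrite !(e1, e2, e3).
Qed.

Lemma dotC u v : dot u v = dot v u. Proof. by rewrite !dotE; ring. Qed.

Lemma dotDr u v w : dot u (v + w) = dot u v + dot u w.
Proof. by rewrite !dotE !mxE; ring. Qed.

Lemma dotZr (t : R) u v : dot u (t *: v) = t * dot u v.
Proof. by rewrite !dotE !mxE; ring. Qed.

Lemma dotNr u v : dot u (- v) = - dot u v.
Proof. by rewrite !dotE !mxE; ring. Qed.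

Lemma dotBr u v w : dot u (v - w) = dot u v - dot u w.
Proof. by rewrite dotDr dotNr. Qed.

Lemma dotBl u v w : dot (u - v) w = dot u w - dot v w.
Proof. by rewrite dotC dotBr !(dotC w). Qed.

Lemma dot0r u : dot u 0 = 0. Proof. by rewrite dotE !mxE; ring. Qed.

Lemma dot_sum (m : nat) (lam : 'I_m -> R) (f : 'I_m -> 'rV[R]_3) u :
  dot u (\sum_i lam i *: f i) = \sum_i lam i * dot u (f i).
Proof.
elim/big_rec2: _ => [|i a b _ <-]; first exact: dot0r.
by rewrite dotDr dotZr.
Qed.

Lemma dot_gt0 u : u != 0 -> 0 < dot u u.
Proof.
move=> nz; have ge0 : 0 <= dot u u by rewrite dotE -!expr2 !addr_ge0 ?sqr_ge0.
rewrite lt_neqAle ge0 andbT eq_sym; apply: contra nz.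
rewrite dotE -!expr2 !paddr_eq0 ?addr_ge0 ?sqr_ge0 // !sqrf_eq0 => /andP[/andP[/eqP e1 /eqP e2] /eqP e3].
by apply/eqP/vecP; rewrite ?mxE.
Qed.

Lemma dot_cross u v : dot u (crossmul u v) = 0 /\ dot v (crossmul u v) = 0.
Proof. by rewrite !dotE !crossmulE; split; ring. Qed.

Lemma cross_dot_self u v :
  dot (crossmul u v) (crossmul u v) = dot u u * dot v v - dot u v ^+ 2.
Proof. by rewrite !dotE !crossmulE; ring. Qed.

(** The vectors [a], [u] and [crossmul a u] form an orthogonal basis, and [y] is orthogonal to the
    first and the third. *)
Lemma collinear_in_plane a u y : a != 0 -> u != 0 -> dot a u = 0 -> dot a y = 0 ->
  dot (crossmul a u) y = 0 -> exists t, y = t *: u.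
Proof.
move=> /dot_gt0 a0 /dot_gt0 u0 au ay nay; exists (dot y u / dot u u).
have key k : dot a a * dot u u * y 0 k = dot a a * dot y u * u 0 k.
  apply/eqP; rewrite -subr_eq0; apply/eqP.
  transitivity (dot a y * (dot u u * a 0 k - dot a u * u 0 k) -
    dot a u * (dot u y * a 0 k - dot a u * y 0 k) +
    dot (crossmul a u) y * crossmul a u 0 k); last by rewrite au ay nay; ring.
  by rewrite !dotE; case: (ord3P k) => ->; rewrite !crossmulE; ring.
apply/rowP => k; rewrite !mxE.
apply: (mulfI (lt0r_neq0 (mulr_gt0 a0 u0))); rewrite key.
by field; apply/negP => /eqP e; rewrite e ltxx in u0.
Qed.

(* A planar Killing field is determined by its values at two points: here the
   origin, where it vanishes, and u. *)
Lemma glue_rigid u w Qd Qi Qj (a b a' b' : R) : b != 0 -> b' != 0 -> dot Qd u = 0 ->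
  dot Qi (a *: u + b *: w) = 0 -> dot (Qi - Qd) (a *: u + b *: w - u) = 0 ->
  dot Qj (a' *: u + b' *: w) = 0 -> dot (Qj - Qd) (a' *: u + b' *: w - u) = 0 ->
  dot (Qi - Qj) ((a *: u + b *: w) - (a' *: u + b' *: w)) = 0.
Proof.
move=> b0 b0' du; rewrite !(dotBl, dotBr, dotDr, dotZr) du.
move=> i1 i2 j1 j2.
have ei : dot Qi u = - (b * dot Qd w) by lra.
have ej : dot Qj u = - (b' * dot Qd w) by lra.
have fi : dot Qi w = a * dot Qd w by apply: (mulfI b0); move: i1; rewrite ei; lra.
have fj : dot Qj w = a' * dot Qd w by apply: (mulfI b0'); move: j1; rewrite ej; lra.
by rewrite ei ej fi fj; ring.
Qed.

End Vectors.

Local Ltac ineq := try match goal with |- is_true _ => lra end.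

(** * Convex hulls and extreme points *)

Section Hull.
Variables (R : realType) (m : nat) (p : 'I_m -> 'rV[R]_3).

Lemma in_hull_vertex i : in_hull p (p i).
Proof.
exists (fun k => (k == i)%:R); split; [by move=> k; rewrite ler0n|split].
  by rewrite (bigD1 i) //= eqxx big1 ?addr0 // => k /negbTE->.
by rewrite (bigD1 i) //= eqxx scale1r big1 ?addr0 // => k /negbTE->; rewrite scale0r.
Qed.

Lemma in_hull_seg x y (t : R) : in_hull p x -> in_hull p y -> 0 <= t -> t <= 1 ->
  in_hull p ((1 - t) *: x + t *: y).
Proof.
move=> [l [l0 [l1 ->]]] [l' [l0' [l1' ->]]] t0 t1.
exists (fun k => (1 - t) * l k + t * l' k); split; [|split].
- by move=> k; rewrite addr_ge0 ?mulr_ge0 // subr_ge0.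
- by rewrite big_split /= -!mulr_sumr l1 l1'; ring.
- by rewrite !scaler_sumr -big_split /=; apply: eq_bigr => k _; rewrite !scalerA -scalerDl.
Qed.

Lemma dot_hull_le a b x : (forall i, dot a (p i) <= b) -> in_hull p x -> dot a x <= b.
Proof.
move=> le [l [l0 [l1 ->]]]; rewrite dot_sum.
rewrite -[b]mul1r -l1 mulr_suml; apply: ler_sum => i _; exact: ler_wpM2l.
Qed.

Lemma hull_support a b (l : 'I_m -> R) : (forall i, dot a (p i) <= b) ->
  (forall i, 0 <= l i) -> \sum_i l i = 1 -> dot a (\sum_i l i *: p i) = b ->
  forall i, l i != 0 -> dot a (p i) = b.
Proof.
move=> le l0 l1 e i li; apply/eqP; rewrite -subr_eq0; apply/eqP.
apply: (@weighted_sum_eq0 _ _ l (fun k => dot a (p k) - b)) li => // [k|].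
  by rewrite subr_le0.
under eq_bigr do rewrite mulrBr.
by rewrite sumrB -mulr_suml l1 -dot_sum e; ring.
Qed.

Hypothesis vert : are_vertices p.

(** Merging [y] and [z] into one hull point reduces this to the two-point definition of extremality.
    The merge divides by [b + c], so the case where this sum vanishes is separate. *)
Lemma vertex_combination i x y z (a b c : R) :
  in_hull p x -> in_hull p y -> in_hull p z -> 0 < a -> 0 <= b -> 0 <= c ->
  (a + b + c) *: p i = a *: x + b *: y + c *: z -> x = p i.
Proof.
move=> hx hy hz a0 b0 c0 e.
have [bc0|bc] := eqVneq (b + c) 0.
  have b00 : b = 0 by lra.
  have c00 : c = 0 by lra.
  move: e; rewrite b00 c00 !addr0 !scale0r !addr0 => /scalerI; move/(_ (lt0r_neq0 a0)) => ->.
  by [].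
have bcp : 0 < b + c by rewrite lt_neqAle eq_sym bc addr_ge0.
have abc : 0 < a + b + c by lra.
have bc' : b + c != 0 by [].
pose s := c / (b + c).
have hw : in_hull p ((1 - s) *: y + s *: z).
  apply: in_hull_seg => //; first by rewrite divr_ge0 // ltW.
  by rewrite ler_pdivrMr // mul1r; lra.
have s1 : 0 < (b + c) / (a + b + c) by rewrite divr_gt0.
have s2 : (b + c) / (a + b + c) < 1 by rewrite ltr_pdivrMr // mul1r; lra.
have eq : p i = (1 - (b + c) / (a + b + c)) *: x + ((b + c) / (a + b + c)) *: ((1 - s) *: y + s *: z).
  apply: (scalerI (lt0r_neq0 abc)); rewrite e.
  by apply/rowP => k; rewrite !mxE /s; field; rewrite bc' lt0r_neq0.
have xw := (vert.2 i).2 _ _ _ hx hw s1 s2 eq.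
by rewrite eq -xw -scalerDl subrK scale1r.
Qed.

(** The middle one of three collinear points is a convex combination of the other two, so
    extremality makes it coincide with one of them. *)
Lemma collinear_vertices i c d (s : R) : c != d -> p i = (1 - s) *: p c + s *: p d -> i = c \/ i = d.
Proof.
move=> cd e.
have [[hi hc] hd] := (in_hull_vertex i, in_hull_vertex c, in_hull_vertex d).
have [s0|s0] := ltrP s 0.
  left; apply: vert.1; apply: (@vertex_combination c _ (p d) (p d) 1 (- s) 0) => //; ineq.
  by rewrite e; apply/rowP => k; rewrite !mxE; ring.
have [s1|s1] := ltrP 1 s.
  right; apply: vert.1; apply: (@vertex_combination d _ (p c) (p c) 1 (s - 1) 0) => //; ineq.
  by rewrite e; apply/rowP => k; rewrite !mxE; ring.
have [z|nz] := eqVneq s 0.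
  by left; apply: vert.1; rewrite e z; apply/rowP => k; rewrite !mxE; ring.
have sp : 0 < s by rewrite lt_neqAle eq_sym nz.
right; apply: vert.1; apply/esym; apply: (@vertex_combination i _ (p c) (p c) s (1 - s) 0) => //; ineq.
by rewrite e; apply/rowP => k; rewrite !mxE; ring.
Qed.

End Hull.

(** * Rigidity inside one triangulated face *)

Section Triangulated.
Variables (R : realType) (m : nat) (p : 'I_m -> 'rV[R]_3).
Hypothesis vert : are_vertices p.
Variables (a : 'rV[R]_3) (b : R).
Hypothesis a0 : a != 0.

(** Within a plane normal to [a], the sign tells on which side of the line through [p c] and [p d]
    the point lies. *)
Let side c d x := dot (crossmul a (p d - p c)) (x - p c).
Let sideD c d (t : R) x y : side c d ((1 - t) *: x + t *: y) = (1 - t) * side c d x + t * side c d y.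
Proof. by rewrite /side !(dotBr, dotDr, dotZr); ring. Qed.
Let side_l c d : side c d (p c) = 0.
Proof. by rewrite /side subrr dot0r. Qed.
Let side_r c d : side c d (p d) = 0.
Proof. by rewrite /side dotC (dot_cross _ _).2. Qed.

Let on_line c d x : c != d -> dot a (p c) = b -> dot a (p d) = b -> dot a x = b ->
  side c d x = 0 -> exists s, x = (1 - s) *: p c + s *: p d.
Proof.
move=> cd ac ad ax sx.
have [|||t e] := @collinear_in_plane _ a (p d - p c) (x - p c) a0 _ _ _ sx.
- by rewrite subr_eq0; apply: contra cd => /eqP /vert.1 ->.
- by rewrite dotBr ac ad subrr.
- by rewrite dotBr ac ax subrr.
by exists t; rewrite -[x](subrK (p c)) e; apply/rowP => k; rewrite !mxE; ring.
Qed.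

Let on_line_vertex c d i : c != d -> dot a (p c) = b -> dot a (p d) = b -> dot a (p i) = b ->
  side c d (p i) = 0 -> i = c \/ i = d.
Proof.
by move=> cd ac ad ai si; have [s] := on_line cd ac ad ai si; exact: collinear_vertices.
Qed.

(** The segment from [i] to [j] meets the line of [c] and [d]. If it did so outside the open
    segment, the nearer end would be a convex combination with positive weight on [p i], against
    extremality. *)
Let separated_crossing c d i j : c != d -> dot a (p c) = b -> dot a (p d) = b ->
  dot a (p i) = b -> dot a (p j) = b -> 0 < side c d (p i) -> side c d (p j) < 0 ->
  crossing p i j c d /\ crossing p c d i j.
Proof.
move=> cd ac ad ai aj si sj.
suff [x xij xcd] : exists2 x, open_seg (p i) (p j) x & open_seg (p c) (p d) x.
  by split; exists x.
pose t := side c d (p i) / (side c d (p i) - side c d (p j)).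
have den : 0 < side c d (p i) - side c d (p j) by lra.
have t0 : 0 < t by rewrite divr_gt0.
have t1 : t < 1 by rewrite ltr_pdivrMr // mul1r; lra.
pose x := (1 - t) *: p i + t *: p j.
have sx : side c d x = 0.
  by rewrite /x sideD /t; field; exact: lt0r_neq0.
have ax : dot a x = b by rewrite /x dotDr !dotZr ai aj; ring.
have [s xs] := on_line cd ac ad ax sx.
exists x; first by exists t.
have [hi hj] := (in_hull_vertex p i, in_hull_vertex p j).
have [hc hd] := (in_hull_vertex p c, in_hull_vertex p d).
exists s; split; [|split] => //.
  rewrite ltNge; apply/negP => s0; suff /vert.1 ic : p i = p c by rewrite ic side_l ltxx in si.
  apply: (@vertex_combination _ _ _ vert c _ (p j) (p d) (1 - t) t (- s)) => //; ineq.
  rewrite -/x xs; apply/rowP => k; rewrite !mxE; ring.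
rewrite ltNge; apply/negP => s0; suff /vert.1 ic : p i = p d by rewrite ic side_r ltxx in si.
apply: (@vertex_combination _ _ _ vert d _ (p j) (p c) (1 - t) t (s - 1)) => //; ineq.
rewrite -/x xs; apply/rowP => k; rewrite !mxE; ring.
Qed.

Variables (D : 'I_m -> 'I_m -> Prop) (q : 'I_m -> 'rV[R]_3).
Hypothesis trD : diag_triangulation p D.
Hypothesis flex : inf_flex p D q.
Hypothesis nbf : nonbase_face p a b.

Let good i j := dot (q i - q j) (p i - p j) = 0.

Let good_sym i j : good i j -> good j i.
Proof. by rewrite /good => <-; rewrite !dotE !mxE; ring. Qed.

(* Induction on S: a diagonal of D separating two vertices of S splits S into two
   smaller parts sharing its ends; if there is none, every pair in S is an edge or
   belongs to D. *)
Lemma face_pairs_rigid (S : {set 'I_m}) : (forall i, i \in S -> dot a (p i) = b) ->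
  (forall i j k l, k \in S -> l \in S -> D i j -> crossing p i j k l -> (i \in S) && (j \in S)) ->
  forall i j, i \in S -> j \in S -> good i j.
Proof.
have [Dsym [Ddiag [Dnc Dmax]]] := trD.
have Dne i j : D i j -> i != j by move=> /Ddiag[? [? [_ []]]].
have [n] := ubnP #|S|; elim: n S => // n IH S leS Sab Scl i j iS jS.
have [[c [d [k [l [[Dcd cS dS] [kS lS sk sl]]]]]]|nsep] := pselect (exists c d k l,
  [/\ D c d, c \in S & d \in S] /\
  [/\ k \in S, l \in S, 0 < side c d (p k) & side c d (p l) < 0]); last first.
  have [->|ij] := eqVneq i j; first by rewrite /good !subrr dot0r.
  have [eij|neij] := pselect (edge p i j); first by apply: flex.1; left.
  have [Dij|nDij] := pselect (D i j); first by apply: flex.1; right.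
  (* Maximality yields a crossing diagonal, with ends in [S] by closure. As it does not separate [i]
     from [j], both lie on its line, so they are its ends and [D i j] holds after all. *)
  have [|c [d [Dcd cr]]] := Dmax a b nbf i j _ nDij; first by do !split; rewrite ?Sab.
  have /andP[cS dS] := Scl _ _ _ _ iS jS Dcd cr.
  have [cd [ac ad]] := (Dne _ _ Dcd, (Sab _ cS, Sab _ dS)).
  have [x [[s [s0 [s1 xs]]] [t [t0 [t1 xt]]]]] := cr.
  have : side c d x = 0 by rewrite xs sideD side_l side_r; ring.
  rewrite xt sideD => e.
  have [si|si|si] := ltgtP (side c d (p i)) 0.
  - have sj : 0 < side c d (p j).
      have : (1 - t) * side c d (p i) < 0 by rewrite pmulr_rlt0 // subr_gt0.
      by move=> h; rewrite -(pmulr_rgt0 _ t0); lra.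
    by case: nsep; exists c, d, j, i; do !split.
  - have sj : side c d (p j) < 0.
      have : 0 < (1 - t) * side c d (p i) by rewrite pmulr_rgt0 // subr_gt0.
      by move=> h; rewrite -(pmulr_rlt0 _ t0); lra.
    by case: nsep; exists c, d, i, j; do !split.
  - have sj : side c d (p j) = 0.
      by apply: (mulfI (lt0r_neq0 t0)); move: e; rewrite si; lra.
    have [ic|id] := on_line_vertex cd ac ad (Sab _ iS) si;
    have [jc|jd] := on_line_vertex cd ac ad (Sab _ jS) sj; case: nDij.
    - by rewrite ic jc eqxx in ij.
    - by rewrite ic jd.
    - by rewrite id jc; exact: Dsym.
    - by rewrite id jd eqxx in ij.
have [cd [ac ad]] := (Dne _ _ Dcd, (Sab _ cS, Sab _ dS)).
(* The sign [e] selects a closed side of the diagonal. That part of [S] is smaller, since it loses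
   [l] or [k]. *)
have half (e : R) : e ^+ 2 = 1 -> forall i j, i \in S -> j \in S ->
    0 <= e * side c d (p i) -> 0 <= e * side c d (p j) -> good i j.
  move=> e2 i' j' iS' jS' si' sj'.
  pose S1 := [set u in S | 0 <= e * side c d (p u)].
  apply: (IH S1); rewrite ?inE ?iS' ?jS' //.
  - rewrite ltnS in leS; apply: (leq_trans _ leS); apply: proper_card; rewrite properE; apply/andP; split.
      by apply/subsetP => u; rewrite inE => /andP[].
    have [e1|e1] : e = 1 \/ e = -1.
      by move/eqP: e2; rewrite sqrf_eq1 => /orP[/eqP|/eqP]; [left|right].
      apply/subsetPn; exists l => //; rewrite inE lS e1 /= -ltNge; lra.
    apply/subsetPn; exists k => //; rewrite inE kS e1 /= -ltNge; lra.
  - by move=> u; rewrite inE => /andP[/Sab].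
  move=> u v w z; rewrite !inE => /andP[wS sw] /andP[zS sz] Duv cr.
  have /andP[uS vS] := Scl _ _ _ _ wS zS Duv cr; rewrite uS vS /=.
  have [x [[s [s0 [s1 xs]]] [t [t0 [t1 xt]]]]] := cr.
  have sx : 0 <= e * side c d x.
    rewrite xt sideD mulrDr !(mulrCA e); apply: addr_ge0; apply: mulr_ge0 => //; lra.
  (* A diagonal of [D] through [x] has no end on the wrong side: it would cross [c d], hence be
     equal to it, and then its ends would lie on the line. *)
  have tr (u' v' : 'I_m) (r : R) : u' \in S -> v' \in S -> 0 < r -> r < 1 -> D u' v' ->
       x = (1 - r) *: p u' + r *: p v' -> 0 <= e * side c d (p u').
    move=> uS' vS' r0 r1 D' xr; rewrite leNgt; apply/negP => su.
    have [sv|sv] := ltrP 0 (e * side c d (p v')).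
      have : (u' = c /\ v' = d) \/ (u' = d /\ v' = c).
        have [ep|en] : e = 1 \/ e = -1.
          by move/eqP: e2; rewrite sqrf_eq1 => /orP[/eqP|/eqP]; [left|right].
          rewrite ep !mul1r in su sv; apply: (Dnc _ _ _ _ D' Dcd).
          have [[y [y1 y2]] _] := @separated_crossing c d v' u' cd ac ad (Sab _ vS')
            (Sab _ uS') ltac:(lra) ltac:(lra).
          exists y; split=> //; case: y1 => r' [r0' [r1' ->]]; exists (1 - r').
          by split; [lra|split; [lra|]]; apply/rowP => k'; rewrite !mxE; ring.
        rewrite en !mulN1r in su sv; apply: (Dnc _ _ _ _ D' Dcd).
        exact: (@separated_crossing c d u' v' cd ac ad (Sab _ uS') (Sab _ vS') ltac:(lra) ltac:(lra)).1.
      by case=> [[uc vd]|[ud vc]]; subst; rewrite ?side_l ?side_r mulr0 ltxx in su.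
    have : (1 - r) * (e * side c d (p u')) < 0 by rewrite pmulr_rlt0 // subr_gt0.
    have : r * (e * side c d (p v')) <= 0 by rewrite pmulr_rle0.
    by move: sx; rewrite xr sideD mulrDr !(mulrCA e); lra.
  rewrite (tr u v s) //= (tr v u (1 - s)) //; ineq; first exact: Dsym.
  by rewrite xs; apply/rowP => k'; rewrite !mxE; ring.
have half1 i' j' : i' \in S -> j' \in S -> 0 <= side c d (p i') -> 0 <= side c d (p j') -> good i' j'.
  by move=> iS' jS' si sj; apply: (half 1); rewrite ?expr1n // mul1r.
have half2 i' j' : i' \in S -> j' \in S -> side c d (p i') <= 0 -> side c d (p j') <= 0 -> good i' j'.
  by move=> iS' jS' si sj; apply: (half (-1)); rewrite ?sqrrN ?expr1n // mulN1r oppr_ge0.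
pose u := p d - p c; pose w := crossmul a u.
have u0 : u != 0 by rewrite subr_eq0; apply: contra cd => /eqP /vert.1 ->.
have au : dot a u = 0 by rewrite /u dotBr ac ad subrr.
have w0 : 0 < dot w w.
  by rewrite /w cross_dot_self au expr0n /= subr0 mulr_gt0 ?dot_gt0.
(* Coordinates about [p c] in the orthogonal frame [u], [w]. The second one is nonzero off the line,
   as [glue_rigid] requires. *)
have dec i' : i' \in S -> exists t, p i' - p c = t *: u + (side c d (p i') / dot w w) *: w.
  move=> iS'; pose r := side c d (p i') / dot w w.
  have [||t e] := @collinear_in_plane _ a u (p i' - p c - r *: w) a0 u0 au.
  - by rewrite !(dotBr, dotZr) ac (Sab _ iS') (dot_cross _ _).1; ring.
  - by rewrite dotBr dotZr -/w -/(side c d (p i')) /r divfK ?subrr // lt0r_neq0.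
  by exists t; rewrite -e subrK.
have glued i' j' : i' \in S -> j' \in S -> 0 < side c d (p i') -> side c d (p j') < 0 -> good i' j'.
  move=> iS' jS' si sj.
  have [t et] := dec _ iS'; have [t' et'] := dec _ jS'.
  have sc := side_l c d; have sd := side_r c d.
  have gdc : good d c by apply: half1; rewrite ?sc ?sd.
  have gic : good i' c by apply: half1; rewrite ?sc ?sd // ltW.
  have gid : good i' d by apply: half1; rewrite ?sc ?sd // ltW.
  have gjc : good j' c by apply: half2; rewrite ?sc ?sd // ltW.
  have gjd : good j' d by apply: half2; rewrite ?sc ?sd // ltW.
  have := @glue_rigid _ u w (q d - q c) (q i' - q c) (q j' - q c)
    t (side c d (p i') / dot w w) t' (side c d (p j') / dot w w).
  rewrite -et -et' => gl.
  have cancel (x y z : 'rV[R]_3) : x - z - (y - z) = x - y by rewrite opprB addrA subrK.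
  rewrite /good -(cancel (q i') (q j') (q c)) -(cancel (p i') (p j') (p c)).
  apply: gl => //; rewrite /u ?cancel //; apply: mulf_neq0; rewrite ?invr_eq0;
    by rewrite ?(lt0r_neq0 w0) ?(lt0r_neq0 si) // lt_eqF.
have [si|si] := lerP 0 (side c d (p i)); have [sj|sj] := lerP 0 (side c d (p j)).
- exact: half1.
- have [si0|si0] := eqVneq (side c d (p i)) 0; first by apply: half2 => //; rewrite ?si0 // ltW.
  by apply: glued => //; rewrite lt_neqAle eq_sym si0.
- have [sj0|sj0] := eqVneq (side c d (p j)) 0; first by apply: half2 => //; rewrite ?sj0 // ltW.
  by apply/good_sym/glued => //; rewrite lt_neqAle eq_sym sj0.
- by apply: half2 => //; exact: ltW.
Qed.

End Triangulated.

(** * Rigidity on supporting planes, through faces or edges *)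

Section Faces.
Variables (R : realType) (m : nat) (p : 'I_m -> 'rV[R]_3).
Variables (D : 'I_m -> 'I_m -> Prop) (q : 'I_m -> 'rV[R]_3).
Hypothesis vert : are_vertices p.
Hypothesis trD : diag_triangulation p D.
Hypothesis flex : inf_flex p D q.

(** Either the plane contains three non-collinear hull points, and then it cuts out a face that [v]
    keeps from being the base; or its vertices are collinear, hence only [i] and [j], and these span
    an edge. *)
Lemma supporting_pairs_rigid (a : 'rV[R]_3) (b : R) v i j : a != 0 ->
  (forall l, dot a (p l) <= b) -> dot a (p v) = b -> zc (p v) != 0 ->
  dot a (p i) = b -> dot a (p j) = b -> dot (q i - q j) (p i - p j) = 0.
Proof.
move=> a0 le av zv ai aj.
have sup : supporting p a b by split=> // x; exact: dot_hull_le.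
have [ij|ij] := eqVneq i j; first by rewrite ij !subrr dot0r.
have [f2|nf2] := pselect (face2 p a b).
  have nbf : nonbase_face p a b.
    split=> // /(_ (p v))[h _]; have [|_ z0] := h; first by split=> //; exact: in_hull_vertex.
    by rewrite z0 eqxx in zv.
  apply: (@face_pairs_rigid _ _ _ vert a b a0 D q trD flex nbf [set l | dot a (p l) == b]).
  - by move=> l; rewrite inE => /eqP.
  (* A segment in the hull with an inner point on the supporting plane has both ends on it. *)
  - move=> c d k l; rewrite !inE => /eqP ak /eqP al _ [x [[s [s0 [s1 xs]]] [t [t0 [t1 xt]]]]].
    have ax : dot a x = b by rewrite xt dotDr !dotZr ak al; ring.
    have ac := le c; have ad := le d.
    have e : (1 - s) * (b - dot a (p c)) + s * (b - dot a (p d)) = 0.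
      by move: ax; rewrite xs dotDr !dotZr; lra.
    have n1 : 0 <= (1 - s) * (b - dot a (p c)) by rewrite mulr_ge0; lra.
    have n2 : 0 <= s * (b - dot a (p d)) by rewrite mulr_ge0; lra.
    have /eqP : (1 - s) * (b - dot a (p c)) = 0 by lra.
    have /eqP : s * (b - dot a (p d)) = 0 by lra.
    rewrite !mulf_eq0 (gt_eqF s0) /= subr_eq0 => /eqP <-.
    by rewrite subr_eq0 (gt_eqF s1) /= subr_eq0 eqxx andbT eq_sym.
  - by rewrite inE; exact/eqP.
  - by rewrite inE; exact/eqP.
apply: flex.1; left; split=> //; exists a, b; split=> // x; split; last first.
  move=> [t [t0 [t1 ->]]]; split; last by rewrite dotDr !dotZr ai aj; ring.
  by apply: in_hull_seg => //; exact: in_hull_vertex.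
have only l : dot a (p l) = b -> l = i \/ l = j.
  move=> al.
  have cr : crossmul (p j - p i) (p l - p i) = 0.
    apply/eqP/negPn/negP => ne; apply: nf2; split=> //; exists (p i), (p j), (p l).
    by do !split=> //; exact: in_hull_vertex.
  have u0 : p j - p i != 0 by rewrite subr_eq0; apply: contra ij => /eqP /vert.1 ->.
  have [||| t e] := @collinear_in_plane _ a (p j - p i) (p l - p i) a0 u0.
  - by rewrite dotBr ai aj subrr.
  - by rewrite dotBr ai al subrr.
  - transitivity (dot a (crossmul (p j - p i) (p l - p i))); last by rewrite cr dot0r.
    by rewrite !dotE !crossmulE; ring.
  apply: (@collinear_vertices _ _ _ vert l i j t ij).
  by rewrite -[p l](subrK (p i)) e; apply/rowP => k; rewrite !mxE; ring.
move=> [[lam [l0 [l1 ->]]] e].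
have supp := hull_support le l0 l1 e.
have zero k : k != i -> k != j -> lam k = 0.
  move=> ki kj; apply/eqP/negPn/negP => /supp/only[] h; by rewrite h eqxx in ki kj.
have l1' : lam i + lam j = 1.
  rewrite -l1 (bigD1 i) //= (bigD1 j) 1?eq_sym //= big1 ?addr0 // => k /andP[ki kj]; exact: zero.
exists (lam j); split=> //; split; first by have := l0 i; lra.
rewrite (bigD1 i) //= (bigD1 j) 1?eq_sym //= big1 ?addr0; last first.
  by move=> k /andP[ki kj]; rewrite zero // scale0r.
by rewrite -l1' addrK.
Qed.

End Faces.

(** * Convex caps *)

Section Cap.
Variables (R : realType) (m : nat) (p : 'I_m -> 'rV[R]_3).
Hypothesis vert : are_vertices p.
Hypothesis cap : convex_cap p.
Hypothesis d3 : dim3 p.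

Let X i := p i 0 ix.
Let Y i := p i 0 iy.
Let Z i := p i 0 iz.

Lemma cap_ge0 i : 0 <= Z i.
Proof. by apply: cap.1; exact: in_hull_vertex. Qed.

Lemma cap_wide h0 h1 h2 : (forall l, h0 + h1 * X l + h2 * Y l = 0) -> h1 = 0 /\ h2 = 0.
Proof.
move=> e; have /rowP a0 : mkvec h1 h2 0 = 0.
  by apply: (d3 (b := - h0)) => i; rewrite dotE !mkvecE; have := e i; rewrite /X /Y; lra.
by have := a0 ix; have := a0 iy; rewrite !mxE /= => -> ->.
Qed.

Lemma cap_not_flat : ~ (forall l, Z l = 0).
Proof.
move=> z; have /rowP a0 : mkvec 0 0 1 = 0 :> 'rV[R]_3.
  by apply: (d3 (b := 0)) => i; rewrite dotE !mkvecE; have := z i; rewrite /Z; lra.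
by have := a0 iz; rewrite !mxE /= => /eqP; rewrite oner_eq0.
Qed.

Lemma cap_inhabited : exists l : 'I_m, True.
Proof.
have [//|none] := pselect (exists l : 'I_m, True); case: cap_not_flat => l.
by case: none; exists l.
Qed.

Lemma in_hull3 x y z (a b c : R) : in_hull p x -> in_hull p y -> in_hull p z ->
  0 <= a -> 0 <= b -> 0 <= c -> 0 < a + b + c ->
  in_hull p ((a + b + c)^-1 *: (a *: x + b *: y + c *: z)).
Proof.
move=> [l [l0 [l1 ->]]] [l' [l0' [l1' ->]]] [l'' [l0'' [l1'' ->]]] a0 b0 c0 s.
exists (fun k => (a + b + c)^-1 * (a * l k + b * l' k + c * l'' k)); split; [|split].
- move=> k; rewrite mulr_ge0 ?invr_ge0 ?(ltW s) //.
  by rewrite !addr_ge0 // mulr_ge0.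
- rewrite -mulr_sumr !big_split /= -!mulr_sumr l1 l1' l1'' !mulr1 mulVf //; exact: lt0r_neq0.
- rewrite !scaler_sumr -!big_split /= scaler_sumr; apply: eq_bigr => k _.
  by rewrite !scalerA -!scalerDl scalerA.
Qed.

Lemma combination_rot (x y z w : 'rV[R]_3) (a b c : R) :
  (a + b + c) *: x = a *: y + b *: z + c *: w -> (b + c + a) *: x = b *: z + c *: w + a *: y.
Proof. by move=> e; rewrite addrC addrA e -addrA addrC. Qed.

(** Some weight is positive, and [vertex_combination] identifies the vertex carrying it with [i]. *)
Lemma vertex_not_balanced i : ~ (exists j k l a b c, [/\ j != i, k != i & l != i] /\
  [/\ 0 <= a, 0 <= b, 0 <= c & 0 < a + b + c] /\
  [/\ a * (X j - X i) + b * (X k - X i) + c * (X l - X i) = 0,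
      a * (Y j - Y i) + b * (Y k - Y i) + c * (Y l - Y i) = 0 &
      a * (Z j - Z i) + b * (Z k - Z i) + c * (Z l - Z i) = 0]).
Proof.
move=> [j [k [l [a [b [c [[ji ki li] [[a0 b0 c0 s] [ex ey ez]]]]]]]]].
have e : (a + b + c) *: p i = a *: p j + b *: p k + c *: p l.
  by apply: vecP; rewrite !mxE; move: ex ey ez; rewrite /X /Y /Z; lra.
have hv := in_hull_vertex p.
have [a1|a1] := ltrP 0 a.
  by have /vert.1 := vertex_combination vert (hv j) (hv k) (hv l) a1 b0 c0 e; move/eqP: ji.
have [b1|b1] := ltrP 0 b.
  have e' := combination_rot e.
  by have /vert.1 := vertex_combination vert (hv k) (hv l) (hv j) b1 c0 a0 e'; move/eqP: ki.
have c1 : 0 < c by lra.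
have e' := combination_rot (combination_rot e).
by have /vert.1 := vertex_combination vert (hv l) (hv j) (hv k) c1 a0 b0 e'; move/eqP: li.
Qed.

Lemma proj_in_hull i : in_hull p (vproj (p i)).
Proof. by apply: cap.2.2; exact: in_hull_vertex. Qed.

Lemma vprojE (x : 'rV[R]_3) : (vproj x 0 ix = x 0 ix) * (vproj x 0 iy = x 0 iy) * (vproj x 0 iz = 0).
Proof. by rewrite !mxE. Qed.

(* Otherwise the vertex would lie strictly between its projection and a point above it. *)
Lemma raised_vertex_top v j k l (a b c : R) : 0 < Z v ->
  0 <= a -> 0 <= b -> 0 <= c -> 0 < a + b + c ->
  (a + b + c) * X v = a * X j + b * X k + c * X l ->
  (a + b + c) * Y v = a * Y j + b * Y k + c * Y l ->
  a * Z j + b * Z k + c * Z l <= (a + b + c) * Z v.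
Proof.
move=> zv a0 b0 c0 s ex ey; rewrite leNgt; apply/negP => lt.
have hv := in_hull_vertex p.
pose w := (a + b + c)^-1 *: (a *: p j + b *: p k + c *: p l).
have hw : in_hull p w by exact: in_hull3.
have s0 := lt0r_neq0 s.
have wx : w 0 ix = X v by rewrite !mxE -/(X j) -/(X k) -/(X l) -ex mulKf.
have wy : w 0 iy = Y v by rewrite !mxE -/(Y j) -/(Y k) -/(Y l) -ey mulKf.
have wz : Z v < w 0 iz by rewrite !mxE -/(Z j) -/(Z k) -/(Z l) mulrC ltr_pdivlMr // mulrC.
have w0 : 0 < w 0 iz by exact: lt_trans wz.
pose t := Z v / w 0 iz.
have t0 : 0 < t by rewrite divr_gt0.
have t1 : t < 1 by rewrite ltr_pdivrMr // mul1r.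
have : vproj (p v) = w.
  apply: ((vert.2 v).2 _ _ t (proj_in_hull v) hw t0 t1); apply: vecP.
  - by rewrite [RHS]mxE [X in X + _]mxE [X in _ + X]mxE vprojE wx /X; ring.
  - by rewrite [RHS]mxE [X in X + _]mxE [X in _ + X]mxE vprojE wy /Y; ring.
  - rewrite [RHS]mxE [X in X + _]mxE [X in _ + X]mxE vprojE mulr0 add0r /t divfK //.
    exact: lt0r_neq0.
by move=> /rowP/(_ iz); rewrite vprojE => e; rewrite -e ltxx in w0.
Qed.

(** The projections of the corners belong to the hull by the cap condition, so extremality of [p i]
    forces one with positive weight to equal [p i]. *)
Lemma base_corner (P : 'I_m -> Prop) i : Z i = 0 -> in_triangle X Y P (X i) (Y i) ->
  exists2 k, P k & X k = X i /\ Y k = Y i.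
Proof.
move=> zi [j [k [l [a [b [c [[Pj Pk Pl] [[a0 b0 c0 s] [ex ey]]]]]]]]].
have e : (a + b + c) *: p i = a *: vproj (p j) + b *: vproj (p k) + c *: vproj (p l).
  have co (x y z : 'rV[R]_3) r : (a *: x + b *: y + c *: z) 0 r = a * x 0 r + b * y 0 r + c * z 0 r.
    by rewrite !mxE.
  apply: vecP; rewrite co !vprojE [LHS]mxE //.
  by rewrite -/(Z i) zi; ring.
have hv := proj_in_hull.
have co u : vproj (p u) = p i -> X u = X i /\ Y u = Y i.
  by move/rowP => e'; have := e' ix; have := e' iy; rewrite !vprojE.
have [a1|a1] := ltrP 0 a.
  by exists j => //; apply: co; apply: (vertex_combination vert (hv j) (hv k) (hv l) a1 b0 c0).
have [b1|b1] := ltrP 0 b.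
  exists k => //; apply: co; apply: (vertex_combination vert (hv k) (hv l) (hv j) b1 c0 a0).
  exact: combination_rot.
have c1 : 0 < c by lra.
exists l => //; apply: co; apply: (vertex_combination vert (hv l) (hv j) (hv k) c1 a0 b0).
exact/combination_rot/combination_rot.
Qed.

(** These are the coordinates of the projection as a convex combination. Heights being nonnegative,
    the last sum lets only base vertices carry weight. *)
Lemma proj_weights i : exists l : 'I_m -> R, [/\ forall k, 0 <= l k, \sum_k l k = 1,
  \sum_k l k * (X k - X i) = 0, \sum_k l k * (Y k - Y i) = 0 & \sum_k l k * Z k = 0].
Proof.
have [l [l0 [l1 e]]] := proj_in_hull i; exists l.
have co c : vproj (p i) 0 c = \sum_k l k * p k 0 c.
  by rewrite e summxE; apply: eq_bigr => k _; rewrite mxE.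
have ce c : vproj (p i) 0 c = p i 0 c -> \sum_k l k * (p k 0 c - p i 0 c) = 0.
  move=> e'; under eq_bigr do rewrite mulrBr.
  by rewrite sumrB -mulr_suml l1 -co e' mul1r subrr.
by split=> //; [apply: ce|apply: ce|]; rewrite ?vprojE // -co vprojE.
Qed.

(** * Velocity fields in coordinates, rigid on every supporting plane that meets a raised vertex *)

Section Flex.
Variables U V W : 'I_m -> R.
Hypothesis rigid : forall n1 n2 n3 b v i j, [|| n1 != 0, n2 != 0 | n3 != 0] ->
  (forall l, n1 * X l + n2 * Y l + n3 * Z l <= b) -> 0 < Z v ->
  n1 * X v + n2 * Y v + n3 * Z v = b -> n1 * X i + n2 * Y i + n3 * Z i = b ->
  n1 * X j + n2 * Y j + n3 * Z j = b ->
  (U i - U j) * (X i - X j) + (V i - V j) * (Y i - Y j) + (W i - W j) * (Z i - Z j) = 0.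
Hypothesis based : forall i, Z i = 0 -> W i = 0.

Lemma roof_rigid a1 a2 b v i j : above X Y Z a1 a2 b -> 0 < Z v -> touch X Y Z a1 a2 b v ->
  touch X Y Z a1 a2 b i -> touch X Y Z a1 a2 b j ->
  (U i - U j) * (X i - X j) + (V i - V j) * (Y i - Y j) + (W i - W j) * (Z i - Z j) = 0.
Proof.
move=> ab zv; rewrite /touch => tv ti tj.
apply: (@rigid (- a1) (- a2) 1 b v i j) => //; [by rewrite oner_eq0 !orbT| |lra|lra|lra].
by move=> l; have := ab l; lra.
Qed.

Lemma wall_rigid n1 n2 v i j : (n1 != 0) || (n2 != 0) ->
  (forall l, n1 * (X l - X v) + n2 * (Y l - Y v) <= 0) -> 0 < Z v ->
  n1 * (X i - X v) + n2 * (Y i - Y v) = 0 -> n1 * (X j - X v) + n2 * (Y j - Y v) = 0 ->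
  (U i - U j) * (X i - X j) + (V i - V j) * (Y i - Y j) + (W i - W j) * (Z i - Z j) = 0.
Proof.
move=> nz le zv ei ej.
apply: (@rigid n1 n2 0 (n1 * X v + n2 * Y v) v i j) => //; [by rewrite eqxx orbF| |lra|lra|lra].
by move=> l; have := le l; lra.
Qed.

(** The projection of [v] is a weighted mean of base vertices on the same wall. Averaging the
    rigidity equations between these and [v] cancels the horizontal terms and leaves a positive
    multiple of [W v]. *)
Lemma wall_vertical_speed n1 n2 v : (n1 != 0) || (n2 != 0) ->
  (forall l, n1 * (X l - X v) + n2 * (Y l - Y v) <= 0) -> 0 < Z v -> W v = 0.
Proof.
move=> nz le zv.
have [l [l0 l1 lx ly lz]] := proj_weights v.
have onw k : l k != 0 -> n1 * (X k - X v) + n2 * (Y k - Y v) = 0.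
  apply: (@weighted_sum_eq0 _ _ l (fun k => n1 * (X k - X v) + n2 * (Y k - Y v))) => //.
  under eq_bigr do rewrite mulrDr !(mulrCA (l _)).
  by rewrite big_split /= -!mulr_sumr lx ly; ring.
have onb k : l k != 0 -> Z k = 0.
  move=> lk; apply/eqP; rewrite -oppr_eq0; apply/eqP.
  apply: (@weighted_sum_eq0 _ _ l (fun k => - Z k)) lk => // [i|].
    by rewrite oppr_le0 cap_ge0.
  by under eq_bigr do rewrite mulrN; rewrite sumrN lz oppr0.
pose N := n1 ^+ 2 + n2 ^+ 2.
have N0 : N != 0 by rewrite paddr_eq0 ?sqr_ge0 // !sqrf_eq0 negb_and.
(* Position and velocity along the trace of the wall; scaling by [N] replaces normalisation of (n1,
   n2). *)
pose t k := n1 * (Y k - Y v) - n2 * (X k - X v).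
pose c k := n1 * V k - n2 * U k.
have tx k : l k != 0 -> N * (X k - X v) = - n2 * t k.
  move=> /onw e; transitivity (n1 * (n1 * (X k - X v) + n2 * (Y k - Y v)) - n2 * t k).
    by rewrite /N /t; ring.
  by rewrite e; ring.
have ty k : l k != 0 -> N * (Y k - Y v) = n1 * t k.
  move=> /onw e; transitivity (n2 * (n1 * (X k - X v) + n2 * (Y k - Y v)) + n1 * t k).
    by rewrite /N /t; ring.
  by rewrite e; ring.
have ev k : l k != 0 -> t k * (c k - c v) + N * (Z v * W v) = 0.
  move=> lk; have := @wall_rigid n1 n2 v k v nz le zv (onw k lk) ltac:(ring).
  rewrite (onb _ lk) (based (onb _ lk)) => /(congr1 (fun x => N * x)); rewrite mulr0 => <-.
  transitivity ((U k - U v) * (N * (X k - X v)) + (V k - V v) * (N * (Y k - Y v)) + N * (Z v * W v)).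
    by rewrite tx // ty // /c; ring.
  by ring.
have ek k k' : l k != 0 -> l k' != 0 -> (t k - t k') * (c k - c k') = 0.
  move=> lk lk'; have := @wall_rigid n1 n2 v k k' nz le zv (onw k lk) (onw k' lk').
  rewrite !(onb _ lk) !(onb _ lk') => /(congr1 (fun x => N * x)); rewrite mulr0 => <-.
  have dX : N * (X k - X k') = - n2 * (t k - t k').
    transitivity (N * (X k - X v) - N * (X k' - X v)); first by ring.
    by rewrite (tx _ lk) (tx _ lk'); ring.
  have dY : N * (Y k - Y k') = n1 * (t k - t k').
    transitivity (N * (Y k - Y v) - N * (Y k' - Y v)); first by ring.
    by rewrite (ty _ lk) (ty _ lk'); ring.
  transitivity ((U k - U k') * (N * (X k - X k')) + (V k - V k') * (N * (Y k - Y k'))).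
    by rewrite dX dY /c; ring.
  by ring.
have [k0 lk0] : exists k, l k != 0.
  have [//|none] := pselect (exists k, l k != 0).
  have : \sum_k l k = 0 by apply: big1 => k _; apply/eqP/negPn/negP => lk; apply: none; exists k.
  by rewrite l1 => /eqP; rewrite oner_eq0.
(* Two base vertices on the wall share [t] or share [c]; either way the equation at [k] may be
   written with [c k0]. *)
have all k : l k * (t k * (c k0 - c v) + N * (Z v * W v)) = 0.
  have [->|lk] := eqVneq (l k) 0; first by rewrite mul0r.
  have /eqP := ek _ _ lk lk0; rewrite mulf_eq0 => /orP[/eqP tt|/eqP cc].
    have -> : t k = t k0 by lra.
    by rewrite ev // mulr0.
  have <- : c k = c k0 by lra.
  by rewrite ev // mulr0.
have : \sum_k l k * (t k * (c k0 - c v) + N * (Z v * W v)) = N * (Z v * W v).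
  under eq_bigr do rewrite mulrDr mulrA.
  rewrite big_split /= -!mulr_suml l1 mul1r.
  suff -> : \sum_k l k * t k = 0 by ring.
  under eq_bigr do rewrite mulrBr !(mulrCA (l _)).
  by rewrite sumrB -!mulr_sumr lx ly; ring.
rewrite big1 => [/eqP|k _]; last exact: all.
by rewrite eq_sym mulf_eq0 (negbTE N0) mulf_eq0 (gt_eqF zv) => /eqP.
Qed.

(** * The maximum principle for the vertical speed *)

Section MaximumPrinciple.
Variable v : 'I_m.
Hypothesis zv : 0 < Z v.
Hypothesis maxW : forall i, W i <= W v.
Hypothesis minZ : forall i, W i = W v -> Z v <= Z i.
Hypothesis interior : forall n1 n2, (n1 != 0) || (n2 != 0) ->
  exists l, 0 < n1 * (X l - X v) + n2 * (Y l - Y v).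

Let dx l := X l - X v.
Let dy l := Y l - Y v.
Let dz l := Z l - Z v.
(** Velocity of [i] relative to [v], paired with the vector from [v] to [l]. It is antisymmetric on
    a roof face, which is why [spin] is the same for all corners of that face. *)
Let A i l := (U i - U v) * dx l + (V i - V v) * dy l + (W i - W v) * dz l.

Let roof_at a1 a2 b := above X Y Z a1 a2 b /\ touch X Y Z a1 a2 b v.
(** A counterclockwise pair on one roof plane at [v]; the two need not be neighbours of [v]. *)
Let corner j k := 0 < cross dx dy j k /\
  exists a1 a2 b, [/\ roof_at a1 a2 b, touch X Y Z a1 a2 b j & touch X Y Z a1 a2 b k].
(* The in-plane angular speed of a roof face at v, seen from above. *)
Let spin j k := A j k / cross dx dy j k.

Let roof_diff a1 a2 b l : roof_at a1 a2 b -> touch X Y Z a1 a2 b l ->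
  dz l = a1 * dx l + a2 * dy l.
Proof. by move=> [_]; rewrite /touch /dz /dx /dy => -> ->; ring. Qed.

Let A_diag a1 a2 b i : roof_at a1 a2 b -> touch X Y Z a1 a2 b i -> A i i = 0.
Proof. by move=> [ab tv] ti; rewrite -(roof_rigid ab zv tv ti tv) /A /dx /dy /dz; ring. Qed.

Let A_anti a1 a2 b i j : roof_at a1 a2 b -> touch X Y Z a1 a2 b i -> touch X Y Z a1 a2 b j ->
  A i j = - A j i.
Proof.
move=> ra ti tj; have ai := A_diag ra ti; have aj := A_diag ra tj; move: ra => [ab tv].
have := roof_rigid ab zv tv ti tj; move: ai aj; rewrite /A /dx /dy /dz => ai aj e.
by apply/eqP; rewrite -subr_eq0; apply/eqP; rewrite -[RHS]subr0 -[in RHS]e; lra.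
Qed.

(** If the heights balance as well, a planar balance lifts to a spatial one, which
    [vertex_not_balanced] excludes. *)
Let unbalanced P : (forall l, P l -> l != v) ->
  (forall j k l a b c, P j -> P k -> P l -> 0 <= a -> 0 <= b -> 0 <= c ->
    a * dx j + b * dx k + c * dx l = 0 -> a * dy j + b * dy k + c * dy l = 0 ->
    a * dz j + b * dz k + c * dz l = 0) -> ~ balanced dx dy P.
Proof.
move=> nv zz [j [k [l [a [b [c [[Pj Pk Pl] [[a0 b0 c0 s] [ex ey]]]]]]]]].
apply: (@vertex_not_balanced v); exists j, k, l, a, b, c.
by split; [split; exact: nv|split; [|split=> //; exact: zz]].
Qed.

(** Some upper face covers the shadow of [v], and it touches [v] by [raised_vertex_top]. Its contact
    points are not collinear, so two of them are independent as seen from [v]. *)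
Let corner_exists : exists j k, corner j k.
Proof.
have [a1 [a2 [b uf]]] := upper_face_exists Z cap_wide cap_inhabited.
have [|||c1 [c2 [d [[ab sp] _ [i [j [k [a [b' [c [[ti tj tk] [[a0 b0 c0 s] [ex ey]]]]]]]]]]]]] :=
  @upper_face_cover _ _ X Y Z (fun _ _ _ => True) (X v) (Y v).
- by exists a1, a2, b.
- by [].
- by move=> h0 h1 h2 neg; exists v.
have tv : touch X Y Z c1 c2 d v.
  apply/le_anti; rewrite ab /=.
  have := raised_vertex_top zv a0 b0 c0 s ex ey; rewrite ti tj tk.
  have -> : a * (d + c1 * X i + c2 * Y i) + b' * (d + c1 * X j + c2 * Y j) + c * (d + c1 * X k + c2 * Y k)
    = (a + b' + c) * d + c1 * (a * X i + b' * X j + c * X k) + c2 * (a * Y i + b' * Y j + c * Y k) by ring.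
  rewrite -ex -ey => le; rewrite -(ler_pM2l s); lra.
have mk i' j' : touch X Y Z c1 c2 d i' -> touch X Y Z c1 c2 d j' -> cross dx dy i' j' != 0 ->
    exists j k, corner j k.
  move=> ti' tj'; rewrite neq_lt => /orP[lt|lt]; [exists j', i'|exists i', j']; split.
  - by move: lt; rewrite /cross; lra.
  - by exists c1, c2, d.
  - by [].
  - by exists c1, c2, d.
case: sp => i' [j' [k' [[ti' tj' tk'] o]]].
have [e1|] := eqVneq (cross dx dy i' j') 0; last exact: mk.
have [e2|] := eqVneq (cross dx dy j' k') 0; last exact: mk.
have [e3|] := eqVneq (cross dx dy k' i') 0; last exact: mk.
exfalso; move/eqP: o; apply.
transitivity (cross dx dy i' j' + cross dx dy j' k' + cross dx dy k' i'); last by rewrite e1 e2 e3; ring.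
by rewrite /orient /cross /dx /dy; ring.
Qed.

(* The next corner k, l lies across the edge vk, where the spin grows by
   t (W v - W k) with t > 0. *)
Let corner_next j0 k0 : corner j0 k0 -> (forall j k, corner j k -> spin j k <= spin j0 k0) ->
  exists k, [/\ 0 < cross dx dy j0 k, W k = W v & exists2 l, corner k l & spin k l = spin j0 k0].
Proof.
move=> [c00 [a1 [a2 [b [ra tj0 tk0]]]]] maxs.
have nv j : 0 < cross dx dy j0 j -> j != v.
  by move=> h; apply/eqP => e; move: h; rewrite e /cross /dx /dy !subrr; lra.
have j0v : j0 != v by apply/eqP => e; move: c00; rewrite e /cross /dx /dy !subrr; lra.
pose P l := touch X Y Z a1 a2 b l /\ l != v.
have nb : ~ balanced dx dy P.
  apply: unbalanced => [l []//|i j k a b' c [ti _] [tj _] [tk _] a0 b0 c0 ex ey].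
  rewrite !(roof_diff ra) //.
  transitivity (a1 * (a * dx i + b' * dx j + c * dx k) + a2 * (a * dy i + b' * dy j + c * dy k)).
    by ring.
  by rewrite ex ey; ring.
have [[k [tk kv] mk]|//] := @extreme_ray_last _ _ dx dy P (ex_intro _ j0 (conj tj0 j0v)).
have kj0 := mk j0 (conj tj0 j0v); have kk0 := mk k0 (conj tk0 (nv _ c00)).
(* The last ray [k] could be parallel to [j0] only by being opposite to it, which would be a
   balance. *)
have j0k : 0 < cross dx dy j0 k.
  rewrite lt_neqAle; apply/andP; split; last by move: kj0; rewrite /cross; lra.
  apply/eqP => e; apply: nb; exists k, j0, j0, (cross dx dy j0 k0), (- cross dx dy k k0), 0.
  split; first by [].
  split; first by split=> //; lra.
  move: e; rewrite /cross => e; split.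
    transitivity (- dx k0 * (dx j0 * dy k - dy j0 * dx k) * -1); first by ring.
    by rewrite -e; ring.
  transitivity (- dy k0 * (dx j0 * dy k - dy j0 * dx k) * -1); first by ring.
  by rewrite -e; ring.
have kn0 : (- dy k != 0) || (dx k != 0).
  rewrite oppr_eq0 -negb_and; apply/negP => /andP[/eqP e1 /eqP e2].
  by move: j0k; rewrite /cross e1 e2; lra.
have [l0 hl0] := interior kn0.
have ho l : (dx k * Y v - dy k * X v) + dy k * X l + - dx k * Y l = - cross dx dy k l.
  by rewrite /cross /dx /dy; ring.
(* Tilt about the line through [v] and [k], lowering the plane on the counterclockwise side, where
   [interior] provides a vertex. *)
have [||t [t0 ab' [l hl tl]]] := @tilt _ _ X Y Z a1 a2 b (dx k * Y v - dy k * X v) (dy k) (- dx k) ra.1.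
- move=> l tl; rewrite ho oppr_ge0; have [->|lv] := eqVneq l v; last exact: mk.
  by rewrite /cross /dx /dy !subrr; lra.
- by exists l0; rewrite ho oppr_lt0; move: hl0; rewrite /cross /dx /dy; lra.
rewrite ho oppr_lt0 in hl.
have tv' : touch X Y Z (a1 + t * dy k) (a2 + t * - dx k) (b + t * (dx k * Y v - dy k * X v)) v.
  by move: ra => [_]; rewrite /touch => ->; ring.
have tk' : touch X Y Z (a1 + t * dy k) (a2 + t * - dx k) (b + t * (dx k * Y v - dy k * X v)) k.
  by move: tk; rewrite /touch => ->; rewrite /dx /dy; ring.
have ra' : roof_at (a1 + t * dy k) (a2 + t * - dx k) (b + t * (dx k * Y v - dy k * X v)) by [].
have ckl : corner k l by split=> //; do 3!eexists; split; [exact: ra'| |].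
have same : spin j0 k = spin j0 k0.
  apply/eqP; rewrite /spin eqr_div ?lt0r_neq0 //; apply/eqP.
  have dA := A_diag ra tj0.
  transitivity (A j0 k0 * cross dx dy j0 k + cross dx dy k k0 * A j0 j0); last by rewrite dA; ring.
  by rewrite /A !(roof_diff ra) // /cross; ring.
have step : spin k l - spin j0 k = t * (W v - W k).
  rewrite /spin (A_anti ra tj0 tk).
  have zl : dz l = a1 * dx l + a2 * dy l - t * cross dx dy k l.
    by rewrite (roof_diff ra' tl) /cross; ring.
  (* The linear relation between the three planar vectors [j0], [k], [l], paired with the relative
     velocity of [k]; the last term comes from the change of slope across the edge. *)
  have key : cross dx dy j0 k * A k l + cross dx dy k l * A k j0 =
     cross dx dy j0 l * A k k + cross dx dy j0 k * cross dx dy k l * (t * (W v - W k)).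
    by rewrite /A zl !(roof_diff ra) // /cross; ring.
  rewrite (A_diag ra tk) mulr0 add0r in key.
  apply: (mulfI (lt0r_neq0 (mulr_gt0 j0k hl))); rewrite -key.
  by field; rewrite !lt0r_neq0.
have le := maxs k l ckl.
have Wk : W k = W v.
  apply/le_anti; rewrite maxW /= -subr_le0 -(pmulr_rle0 _ t0) -step; lra.
exists k; split=> //; exists l => //.
by move: step; rewrite Wk subrr mulr0; lra.
Qed.

(** Start from a corner of maximal spin: each step reaches an edge with [W k = W v] and the same
    spin. Such edges admit no last ray, so they are balanced around [v]. *)
Lemma no_interior_maximum : False.
Proof.
have [|[j0 k0] cm maxs] := @exists_argmax _ _ (fun jk : 'I_m * 'I_m => corner jk.1 jk.2)
  (fun jk => spin jk.1 jk.2).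
  by have [j [k c]] := corner_exists; exists (j, k).
rewrite /= in cm maxs.
pose P k := W k = W v /\ exists2 l, corner k l & spin k l = spin j0 k0.
have next j l : corner j l -> spin j l = spin j0 k0 -> exists2 k, P k & 0 < cross dx dy j k.
  move=> cj sj; have [|k [jk Wk [l' ck sk]]] := corner_next cj.
    by move=> j' k' c'; rewrite sj; exact: (maxs (j', k')).
  by exists k => //; split=> //; exists l' => //; rewrite sk.
have [k1 Pk1 _] := next _ _ cm erefl.
have nv k : P k -> k != v.
  by move=> [_ [l [h _] _]]; apply/eqP => e; move: h; rewrite e /cross /dx /dy !subrr; lra.
have [[k [Wk [l ck sk]] mk]|] := @extreme_ray_last _ _ dx dy P (ex_intro _ k1 Pk1).
  by have [k' /mk le lt] := next _ _ ck sk; move: (lt_le_trans lt le); rewrite ltxx.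
apply: unbalanced => // i j k a b c Pi Pj Pk a0 b0 c0 ex ey.
have zz u : P u -> 0 <= dz u by move=> [/minZ]; rewrite subr_ge0.
have [s0|s] := lerP (a + b + c) 0.
  have -> : a = 0 by lra.
  have -> : b = 0 by lra.
  have -> : c = 0 by lra.
  by ring.
(* By [minZ] the vertices are no lower than [v], while their mean over [v] is no higher; hence the
   heights balance too. *)
have := @raised_vertex_top v i j k a b c zv a0 b0 c0 s
  ltac:(move: ex; rewrite /dx; lra) ltac:(move: ey; rewrite /dy; lra).
have := mulr_ge0 a0 (zz _ Pi); have := mulr_ge0 b0 (zz _ Pj); have := mulr_ge0 c0 (zz _ Pk).
by rewrite /dz; lra.
Qed.

End MaximumPrinciple.

Lemma vertical_speed_le0 i : W i <= 0.
Proof.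
rewrite leNgt; apply/negP => Wi.
have [u _ maxu] := @exists_argmax _ _ (fun _ => True) W (ex_intro _ i Logic.I).
have [v Wv minv] := @exists_argmin _ _ (fun j => W j = W u) Z (ex_intro _ u erefl).
have Wv0 : 0 < W v by rewrite Wv; exact: lt_le_trans (maxu i Logic.I).
have zv : 0 < Z v.
  rewrite lt_neqAle cap_ge0 andbT eq_sym; apply/eqP => /based e.
  by rewrite e ltxx in Wv0.
apply: (@no_interior_maximum v zv) => [j|j|n1 n2 nz].
- by rewrite Wv; exact: maxu.
- by rewrite Wv; exact: minv.
have [//|none] := pselect (exists l, 0 < n1 * (X l - X v) + n2 * (Y l - Y v)).
suff e : W v = 0 by rewrite e ltxx in Wv0.
apply: (wall_vertical_speed nz) => // l; rewrite leNgt; apply/negP => h.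
by apply: none; exists l.
Qed.

(** * One planar rigid motion for all vertices *)

Section Horizontal.
Hypothesis W0 : forall i, W i = 0.

(** If all contact points had height zero, the plane would be the base plane and the cap would be
    flat. *)
Lemma upper_face_raised a1 a2 b : upper_face X Y Z a1 a2 b ->
  exists2 v, 0 < Z v & touch X Y Z a1 a2 b v.
Proof.
move=> [ab [i [j [k [[ti tj tk] o]]]]].
have [//|none] := pselect (exists2 v, 0 < Z v & touch X Y Z a1 a2 b v).
have zero l : touch X Y Z a1 a2 b l -> b + a1 * X l + a2 * Y l = 0.
  move=> tl; rewrite -tl; apply/le_anti; rewrite cap_ge0 andbT leNgt; apply/negP => zl.
  by apply: none; exists l.
have [zi zj zk] : [/\ b + a1 * X i + a2 * Y i = 0, b + a1 * X j + a2 * Y j = 0 &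
  b + a1 * X k + a2 * Y k = 0] by split; exact: zero.
have [a10 a20] : a1 = 0 /\ a2 = 0.
  apply: (@perp_two_eq0 _ a1 a2 (X j - X i) (Y j - Y i) (X k - X i) (Y k - Y i)); [lra|lra|exact: o].
case: cap_not_flat => l; apply/le_anti; rewrite cap_ge0 andbT.
by apply: le_trans (ab l) _; move: zi; rewrite a10 a20; lra.
Qed.

Variables c x0 y0 u0 v0 : R.
(** Velocity left after subtracting the planar rigid motion with angular speed [c] and velocity (u0,
    v0) at (x0, y0). *)
Let U' i := U i - u0 + c * (Y i - y0).
Let V' i := V i - v0 - c * (X i - x0).
Let still i := U' i = 0 /\ V' i = 0.

Let rigid' i j :
  (U i - U j) * (X i - X j) + (V i - V j) * (Y i - Y j) + (W i - W j) * (Z i - Z j) = 0 ->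
  still j -> U' i * (X i - X j) + V' i * (Y i - Y j) = 0.
Proof.
rewrite !W0 subrr mul0r addr0 => e [uj vj].
transitivity ((U' i - U' j) * (X i - X j) + (V' i - V' j) * (Y i - Y j)).
  by rewrite uj vj !subr0.
by rewrite -e /U' /V'; ring.
Qed.

(** A contact [l] off the line of [i] and [j] is fixed by two independent constraints. Any other
    contact sees [i], [j], [l] in directions that are not all parallel. *)
Lemma still_roof a1 a2 b i j : upper_face X Y Z a1 a2 b ->
  touch X Y Z a1 a2 b i -> touch X Y Z a1 a2 b j -> (X j - X i != 0) || (Y j - Y i != 0) ->
  still i -> still j -> forall k, touch X Y Z a1 a2 b k -> still k.
Proof.
move=> uf ti tj ij si sj; have [v zv tv] := upper_face_raised uf; have [ab sp] := uf.
have perp k l : touch X Y Z a1 a2 b k -> touch X Y Z a1 a2 b l -> still l ->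
    U' k * (X k - X l) + V' k * (Y k - Y l) = 0.
  by move=> tk tl sl; apply: rigid' => //; exact: (roof_rigid ab zv tv tk tl).
have [l tl ol] : exists2 l, touch X Y Z a1 a2 b l & orient X Y i j (X l) (Y l) != 0.
  have [//|none] := pselect (exists2 l, touch X Y Z a1 a2 b l & orient X Y i j (X l) (Y l) != 0).
  have fl l : touch X Y Z a1 a2 b l -> orient X Y i j (X l) (Y l) = 0.
    by move=> tl; apply/eqP/negPn/negP => o; apply: none; exists l.
  case: sp => e [f [g [[/fl te /fl tf /fl tg] /eqP o]]]; exfalso; apply: o.
  have e1 : (X j - X i) * orient X Y e f (X g) (Y g) = 0.
    transitivity ((X f - X e) * (orient X Y i j (X g) (Y g) - orient X Y i j (X e) (Y e)) -
      (X g - X e) * (orient X Y i j (X f) (Y f) - orient X Y i j (X e) (Y e))).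
      by rewrite /orient; ring.
    by rewrite te tf tg; ring.
  have e2 : (Y j - Y i) * orient X Y e f (X g) (Y g) = 0.
    transitivity ((Y f - Y e) * (orient X Y i j (X g) (Y g) - orient X Y i j (X e) (Y e)) -
      (Y g - Y e) * (orient X Y i j (X f) (Y f) - orient X Y i j (X e) (Y e))).
      by rewrite /orient; ring.
    by rewrite te tf tg; ring.
  by case/orP: ij => nz; apply: (mulfI nz); rewrite ?e1 ?e2 mulr0.
have sl : still l.
  apply: (perp_two_eq0 (perp l i tl ti si) (perp l j tl tj sj)).
  by apply: contra ol => /eqP e; apply/eqP; rewrite -e /orient; ring.
move=> k tk; have pi := perp k i tk ti si; have pj := perp k j tk tj sj; have pl := perp k l tk tl sl.
have [e1|] := eqVneq ((X k - X i) * (Y k - Y j) - (Y k - Y i) * (X k - X j)) 0; last exact: perp_two_eq0.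
have [e2|] := eqVneq ((X k - X j) * (Y k - Y l) - (Y k - Y j) * (X k - X l)) 0; last exact: perp_two_eq0.
have [e3|] := eqVneq ((X k - X l) * (Y k - Y i) - (Y k - Y l) * (X k - X i)) 0; last exact: perp_two_eq0.
exfalso; move/eqP: ol; apply.
transitivity (((X k - X i) * (Y k - Y j) - (Y k - Y i) * (X k - X j)) +
  ((X k - X j) * (Y k - Y l) - (Y k - Y j) * (X k - X l)) +
  ((X k - X l) * (Y k - Y i) - (Y k - Y l) * (X k - X i))); first by rewrite /orient; ring.
by rewrite e1 e2 e3; ring.
Qed.

Hypothesis still_face : exists a1 a2 b, upper_face X Y Z a1 a2 b /\
  forall k, touch X Y Z a1 a2 b k -> still k.

(** Stillness passes between faces sharing an edge, so some still face covers the shadow of [i]. A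
    raised vertex touches it; a base vertex touches it or lies below one of its contacts, by
    [base_corner]. *)
Lemma still_above i : exists k, [/\ X k = X i, Y k = Y i, still k & k = i \/ (Z i = 0 /\ 0 < Z k)].
Proof.
have [|||a1 [a2 [b [[ab sp] st tri]]]] :=
  @upper_face_cover _ _ X Y Z (fun a1 a2 b => forall k, touch X Y Z a1 a2 b k -> still k) (X i) (Y i).
- exact: still_face.
- move=> a1 a2 b a1' a2' b' j k uf uf' st tj tk tj' tk' jk.
  exact: still_roof uf' tj' tk' jk (st _ tj) (st _ tk).
- by move=> h0 h1 h2 neg; exists i.
have [ti|nti] := pselect (touch X Y Z a1 a2 b i); first by exists i; split=> //; [exact: st|left].
have lt : Z i < b + a1 * X i + a2 * Y i by rewrite lt_neqAle ab andbT; exact/eqP.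
have zi : Z i = 0.
  apply/le_anti; rewrite cap_ge0 andbT leNgt; apply/negP => zi.
  have [j [k [l [a [b' [d [[tj tk tl] [[a0 b0 d0 s] [ex ey]]]]]]]]] := tri.
  have := raised_vertex_top zi a0 b0 d0 s ex ey; rewrite tj tk tl.
  have -> : a * (b + a1 * X j + a2 * Y j) + b' * (b + a1 * X k + a2 * Y k) + d * (b + a1 * X l + a2 * Y l)
    = (a + b' + d) * b + a1 * (a * X j + b' * X k + d * X l) + a2 * (a * Y j + b' * Y k + d * Y l) by ring.
  rewrite -ex -ey => le; move: lt; rewrite ltNge => /negP; apply.
  by rewrite -(ler_pM2l s); lra.
have [k tk [kx ky]] := base_corner zi tri.
exists k; split=> //; first exact: st.
by right; split=> //; rewrite tk kx ky; apply: le_lt_trans lt; rewrite zi.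
Qed.

(* A base vertex below k lies on two vertical supporting planes through k; on each
   of them the motion along its trace vanishes. *)
Lemma all_still i : still i.
Proof.
have [k [kx ky sk [<- //|[zi zk]]]] := still_above i.
pose dx l := X l - X i; pose dy l := Y l - Y i.
pose T l := (dx l != 0) || (dy l != 0).
have nb : ~ balanced dx dy T.
  move=> [j [l [n [a [b [d [Ts [nn [ex ey]]]]]]]]].
  have [|r Tr [rx ry]] := @base_corner T i zi.
    exists j, l, n, a, b, d; split=> //; split=> //.
    by move: ex ey; rewrite /dx /dy; split; lra.
  by move: Tr; rewrite /T /dx /dy rx ry !subrr eqxx.
have neT : exists l, T l.
  have [//|none] := pselect (exists l, T l).
  have [|/eqP] := @cap_wide (- X i) 1 0; last by rewrite oner_eq0.
  move=> l; apply/eqP/negPn/negP => h; apply: none; exists l; apply/orP; left.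
  by apply: contra h => /eqP; rewrite /dx => e; apply/eqP; lra.
have nT l : ~ T l -> dx l = 0 /\ dy l = 0.
  by move/negP; rewrite negb_or !negbK => /andP[/eqP-> /eqP->].
(* A direction bounding all shadows gives a wall through [i] and [k]. On it [i] is compared with a
   still vertex [j'] having the shadow of [j]. *)
have side j n1 n2 : T j -> (n1 != 0) || (n2 != 0) -> n1 * dx j + n2 * dy j = 0 ->
    (forall l, T l -> n1 * dx l + n2 * dy l <= 0) -> U' i * dx j + V' i * dy j = 0.
  move=> Tj nz ej le; have [j' [jx jy sj _]] := still_above j.
  have le' l : n1 * (X l - X k) + n2 * (Y l - Y k) <= 0.
    rewrite kx ky; have [/le//|/nT[]] := pselect (T l).
    by rewrite /dx /dy => -> ->; lra.
  have h : U' i * (X i - X j') + V' i * (Y i - Y j') = 0.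
    apply: rigid' => //; apply: (wall_rigid nz le' zk); rewrite kx ky ?jx ?jy //.
    by rewrite !subrr; ring.
  by move: h; rewrite jx jy /dx /dy; lra.
have [[j1 Tj1 h1]|//] := @extreme_ray _ _ dx dy T neT.
have [[j2 Tj2 h2]|//] := @extreme_ray_last _ _ dx dy T neT.
have p1 : U' i * dx j1 + V' i * dy j1 = 0.
  apply: (@side j1 (dy j1) (- dx j1)) => //; [by rewrite oppr_eq0 orbC|by ring|].
  by move=> l /h1; rewrite /cross; lra.
have p2 : U' i * dx j2 + V' i * dy j2 = 0.
  apply: (@side j2 (- dy j2) (dx j2)) => //; [by rewrite oppr_eq0 orbC|by ring|].
  by move=> l /h2; rewrite /cross; lra.
apply: (perp_two_eq0 p1 p2); apply/eqP => e12.
have [l Tl hl] : exists2 l, T l & 0 < cross dx dy j1 l.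
  have [//|none] := pselect (exists2 l, T l & 0 < cross dx dy j1 l).
  have [|e1 e2] := @cap_wide (dy j1 * X i - dx j1 * Y i) (- dy j1) (dx j1).
    move=> l; transitivity (cross dx dy j1 l); first by rewrite /cross /dx /dy; ring.
    have [Tl|/nT[ex ey]] := pselect (T l); last by rewrite /cross ex ey; ring.
    by apply/le_anti; rewrite h1 // andbT leNgt; apply/negP => h; apply: none; exists l.
  by move: Tj1; rewrite /T e2 eqxx -oppr_eq0 e1 eqxx.
(* Parallel first and last rays, with some shadow off their line, would have to be opposite. *)
apply: nb; exists j2, j1, j1, (cross dx dy j1 l), (- cross dx dy j2 l), 0.
have h2l := h2 l Tl.
split; first by [].
split; first by split=> //; lra.
rewrite /cross; split.
  transitivity (dx l * (dx j1 * dy j2 - dy j1 * dx j2)); first by ring.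
  by rewrite e12; ring.
transitivity (dy l * (dx j1 * dy j2 - dy j1 * dx j2)); first by ring.
by rewrite e12; ring.
Qed.

End Horizontal.

Lemma horizontal_flex_trivial : (forall i, W i = 0) ->
  exists c b1 b2, forall i, U i = - c * Y i + b1 /\ V i = c * X i + b2.
Proof.
move=> W0; have [a1 [a2 [b uf]]] := upper_face_exists Z cap_wide cap_inhabited.
have [v zv tv] := upper_face_raised uf; have [ab [i [j [k [[ti tj tk] o]]]]] := uf.
have N0 : (X j - X i) ^+ 2 + (Y j - Y i) ^+ 2 != 0.
  rewrite paddr_eq0 ?sqr_ge0 // !sqrf_eq0; apply: contra o => /andP[/eqP e1 /eqP e2].
  by rewrite /orient e1 e2 !mul0r subrr.
have ij : (X j - X i != 0) || (Y j - Y i != 0).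
  by move: N0; rewrite paddr_eq0 ?sqr_ge0 // !sqrf_eq0 negb_and.
pose N := (X j - X i) ^+ 2 + (Y j - Y i) ^+ 2.
(* Angular speed of the segment from [i] to [j]: transverse relative velocity over length. With [g],
   the absence of stretching, it determines the motion of [j] relative to [i]. *)
pose c := ((V j - V i) * (X j - X i) - (U j - U i) * (Y j - Y i)) / N.
have g := roof_rigid ab zv tv tj ti; rewrite !W0 subrr mul0r addr0 in g.
have cN : c * N = (V j - V i) * (X j - X i) - (U j - U i) * (Y j - Y i) by rewrite /c divfK.
have st := @all_still W0 c (X i) (Y i) (U i) (V i).
exists c, (U i + c * Y i), (V i - c * X i) => l.
have [|e1 e2] := st _ l; last by split; lra.
exists a1, a2, b; split=> //; apply: (still_roof W0 uf ti tj ij); first by split; ring.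
split; apply: (mulfI N0); rewrite mulr0.
  transitivity ((X j - X i) * ((U j - U i) * (X j - X i) + (V j - V i) * (Y j - Y i)) +
    (Y j - Y i) * (c * N - ((V j - V i) * (X j - X i) - (U j - U i) * (Y j - Y i)))).
    by rewrite /N; ring.
  by rewrite g cN; ring.
transitivity ((Y j - Y i) * ((U j - U i) * (X j - X i) + (V j - V i) * (Y j - Y i)) -
  (X j - X i) * (c * N - ((V j - V i) * (X j - X i) - (U j - U i) * (Y j - Y i)))).
  by rewrite /N; ring.
by rewrite g cN; ring.
Qed.

End Flex.
End Cap.

(** * Return from coordinates to vector-valued flexes *)

Theorem theorem4p10 (R : realType) (m : nat) (p : 'I_m -> 'rV[R]_3) :
  are_vertices p -> convex_cap p -> dim3 p ->
  forall D : 'I_m -> 'I_m -> Prop, diag_triangulation p D ->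
  forall q : 'I_m -> 'rV[R]_3, inf_flex p D q -> trivial_flex p q.
Proof.
move=> vert cap d3 D trD q flex.
have rigid n1 n2 n3 b v i j : [|| n1 != 0, n2 != 0 | n3 != 0] ->
  (forall l, n1 * p l 0 ix + n2 * p l 0 iy + n3 * p l 0 iz <= b) -> 0 < p v 0 iz ->
  n1 * p v 0 ix + n2 * p v 0 iy + n3 * p v 0 iz = b ->
  n1 * p i 0 ix + n2 * p i 0 iy + n3 * p i 0 iz = b ->
  n1 * p j 0 ix + n2 * p j 0 iy + n3 * p j 0 iz = b ->
  (q i 0 ix - q j 0 ix) * (p i 0 ix - p j 0 ix) + (q i 0 iy - q j 0 iy) * (p i 0 iy - p j 0 iy) +
  (q i 0 iz - q j 0 iz) * (p i 0 iz - p j 0 iz) = 0.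
  move=> nz le zv ev ei ej.
  have dE u : dot (mkvec n1 n2 n3) u = n1 * u 0 ix + n2 * u 0 iy + n3 * u 0 iz.
    by rewrite dotE !mkvecE.
  transitivity (dot (q i - q j) (p i - p j)); first by rewrite dotE !mxE.
  apply: (supporting_pairs_rigid vert trD flex (a := mkvec n1 n2 n3) (b := b) (v := v));
    rewrite ?dE //; last exact: lt0r_neq0.
  - apply: contraL nz => /eqP/rowP e.
    have := e ix; have := e iy; have := e iz; rewrite !mxE /= => -> -> ->.
    by rewrite eqxx.
  - by move=> l; rewrite dE.
have W0 i : q i 0 iz = 0.
  apply/le_anti/andP; split.
    apply: (vertical_speed_le0 vert cap d3 rigid) => j zj; exact: flex.2.
  rewrite -oppr_le0.
  (* The bound for the opposite velocity field gives the reverse inequality. *)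
  apply: (vertical_speed_le0 vert cap d3 (U := fun i => - q i 0 ix) (V := fun i => - q i 0 iy)
    (W := fun i => - q i 0 iz)); last by move=> j zj; apply/eqP; rewrite oppr_eq0; apply/eqP/flex.2.
  move=> n1 n2 n3 b v j k nz le zv ev ej ek.
  by rewrite -[RHS]oppr0 -(rigid n1 n2 n3 b v j k) //; ring.
have [c [b1 [b2 e]]] := horizontal_flex_trivial vert cap d3 rigid W0.
exists (mkvec 0 0 c), (mkvec b1 b2 0); split; [|split].
- by split; rewrite mkvecE.
- by rewrite /horizontal /zc mkvecE.
move=> i; have [eu ev] := e i; apply: vecP; rewrite [RHS]mxE crossmulE !mkvecE ?W0 ?eu ?ev; ring.
Qed.
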